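(* Let $\mathcal H$ be a real Hilbert space, $L>0$, $D>0$, $\sigma\ge0$. Let $F:\mathcal H\to\mathcal H$ be monotone and $L$-Lipschitz, $A:\mathcal H\rightrightarrows\mathcal H$ maximally monotone, $z_0\in\mathcal H$, and suppose there is $z_\star$ with $0\in F(z_\star)+A(z_\star)$ and $\|z_0-z_\star\|\le D$. Let $F_\xi(z)=F(z)+\delta_\xi(z)$ be a stochastic oracle with $\mathbb E[\delta_\xi(z)]=0$ and $\mathbb E\|\delta_\xi(z)\|^2\le\sigma^2$ for every $z\in\mathcal H$. Let $N\ge19$ be an integer and set $$\gamma=\frac13,\qquad a_0=\frac{18L}{N},\qquad Q_N=\frac{N/18+1}{\log(N/18)},\qquad m_N=\lfloor\min\{Q_N,N\}\rfloor .$$ Then $Q_N>1$. Run RRSEG for $N$ iterations with parameters $$\eta_k=\frac{1}{3(L+Q_Na_k)},\qquad a_{k+1}=\min\Bigl\{L,\frac{a_k}{1-\gamma\eta_ka_k}\Bigr\},\qquad \lambda_k=a_{k+1}-a_k,$$ and let $\overline F_N:=\frac1{m_N}\sum_{k=N-m_N}^{N-1}F_{\xi_k}(z_k)$ and $\widehat z_N:=J_{\frac1LA}\bigl(z_N-\frac1L\overline F_N\bigr)$. Then $$\begin{aligned}\left(\mathbb E[\mathcal R(\widehat z_N)^2]\right)^{1/2}\le{}&\frac{36\sqrt2LD}{N}+\frac{324\sqrt2LD}{N^2}\left(\sqrt2-1+\frac{77}{32}\right)+\frac{\sqrt2\sigma}{\sqrt{m_N}}\\&+\sigma\sqrt{\frac{5}{2(Q_N+1)}}\left(\log\frac{N}{18}+\sqrt2+\frac94\right).\end{aligned}$$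 Consequently $\mathbb E[\mathcal R(\widehat z_N)^2]=O\left(\frac{L^2D^2}{N^2}+\frac{\sigma^2\log^3N}{N}\right)$, with an absolute implied constant.
   Context: $J_{\alpha A}:=(I+\alpha A)^{-1}$ is the resolvent of $A$; $\mathcal R(z):=\operatorname{dist}(0,F(z)+A(z))$. RRSEG: given $a_0>0$, $c_0=z_0$, $\eta_k>0$, $\lambda_k\ge0$, at each iteration $k\ge0$ draw fresh independent samples $\xi_k,\zeta_k$ (independent of each other and of all previous samples) and set $$\begin{aligned}y_k&=J_{\eta_kA}\bigl(z_k-\eta_k(F_{\xi_k}(z_k)+a_k(z_k-c_k))\bigr),\\ z_{k+1}&=y_k-\eta_k\bigl(F_{\zeta_k}(y_k)+a_k(y_k-c_k)-F_{\xi_k}(z_k)-a_k(z_k-c_k)\bigr),\\ a_{k+1}&=a_k+\lambda_k,\qquad c_{k+1}=\frac{a_kc_k+\lambda_kz_{k+1}}{a_{k+1}}.\end{aligned}$$ *)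

(* Defs.v *)
From HB Require Import structures.
From mathcomp Require Import all_boot all_order all_algebra.
From mathcomp Require Import all_classical all_reals all_analysis.
Import Order.TTheory GRing.Theory Num.Def Num.Theory.
Import numFieldTopology.Exports numFieldNormedType.Exports.

Set Implicit Arguments.
Unset Strict Implicit.
Unset Printing Implicit Defensive.

Local Open Scope classical_set_scope.
Local Open Scope ring_scope.

(* A real Hilbert space is a [completeNormedModType] whose norm comes from a
   positive definite symmetric bilinear form [dot]. *)
Definition norm_of_dot (R : realType) (H : completeNormedModType R)
    (dot : {dot H for idfun}) : Prop :=
  forall x : H, `|x| ^+ 2 = dot x x.

Section Operators.
Context {R : realType} {H : completeNormedModType R}.
Variable dot : {dot H for idfun}.

(* Set-valued operators are maps [A : H -> set H]; [A x u] reads u \in A(x). *)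
Definition monotone_op (A : H -> set H) : Prop :=
  forall x u y v, A x u -> A y v -> 0 <= dot (u - v) (x - y).

Definition maximally_monotone (A : H -> set H) : Prop :=
  monotone_op A /\
  forall B : H -> set H, monotone_op B ->
    (forall x, A x `<=` B x) -> forall x, B x `<=` A x.

Definition monotone_map (F : H -> H) : Prop :=
  forall x y, 0 <= dot (F x - F y) (x - y).

(* (I + alpha A)^-1 (x). It is single valued and everywhere defined when A is
   maximally monotone and alpha > 0; the default value 0 is never used then. *)
Definition resolvent (alpha : R) (A : H -> set H) (x : H) : H :=
  xget 0 [set y | [set y + alpha *: u | u in A y] x].

Definition fwd_sum (F : H -> H) (A : H -> set H) (z : H) : set H :=
  [set F z + u | u in A z].

(* dist (0, F(z) + A(z)), equal to +oo when A(z) is empty *)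
Definition residual (F : H -> H) (A : H -> set H) (z : H) : \bar R :=
  ereal_inf [set `|v|%:E | v in fwd_sum F A z].

End Operators.

Section Randomness.
Context {R : realType}.

Definition borel (T : ptopologicalType) := g_sigma_algebraType (@open T).

Definition separable_set (T : topologicalType) (S : set T) : Prop :=
  exists2 C : set T, countable C & S `<=` closure C.

(* Joint strong measurability. The second clause holds trivially when H is
   separable; for a general H it makes the vectors delta (xi, Z) strongly
   measurable (Borel with separable range) as soon as Z is. *)
Definition strongly_measurable_noise (d : measure_display)
    (Xi : measurableType d) (H : completeNormedModType R)
    (delta : Xi -> H -> H) : Prop :=
  measurable_fun [set: Xi * borel H]
    (fun p : Xi * borel H => delta p.1 p.2 : borel H) /\
  forall S : set H, separable_set S ->
    separable_set [set v | exists s, exists2 z, S z & v = delta s z].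

(* m is the (weak, i.e. Pettis) expectation of the H-valued map X; it is the
   Bochner expectation when X is Bochner integrable. *)
Definition has_mean (H : completeNormedModType R) (dot : {dot H for idfun})
    (d : measure_display) (Xi : measurableType d) (mu : probability Xi R)
    (X : Xi -> H) (m : H) : Prop :=
  forall h : H, mu.-integrable setT (fun s => (dot (X s) h)%:E) /\
    (\int[mu]_s (dot (X s) h)%:E = (dot m h)%:E)%E.

(* Taking some of the B i equal to setT gives the product rule for every
   subfamily. *)
Definition mutually_independent (d d' : measure_display)
    (Omega : measurableType d) (Xi : measurableType d')
    (P : probability Omega R) (I : finType) (X : I -> Omega -> Xi) : Prop :=
  forall B : I -> set Xi, (forall i, measurable (B i)) ->
    P (\bigcap_i (X i @^-1` B i)) = (\prod_(i : I) P (X i @^-1` B i))%E.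

(* The 2N samples xi_0, zeta_0, ..., xi_{N-1}, zeta_{N-1} as one family *)
Definition samples (T : Type) (N : nat) (xi zeta : nat -> T)
    (i : 'I_N + 'I_N) : T :=
  match i with inl k => xi k | inr k => zeta k end.

End Randomness.

(* One trajectory of the algorithm, for fixed sequences of samples. *)
Section RRSEG.
Context {R : realType} {H : completeNormedModType R} {Xi : Type}.
Variables (A : H -> set H) (G : Xi -> H -> H) (z0 : H).
Variables (a0 : R) (eta lambda : nat -> R) (xi zeta : nat -> Xi).

Fixpoint rrseg_a (k : nat) : R :=
  if k is k'.+1 then rrseg_a k' + lambda k' else a0.

Definition rrseg_y (k : nat) (z c : H) : H :=
  resolvent (eta k) A
    (z - eta k *: (G (xi k) z + rrseg_a k *: (z - c))).

(* the pair (z_k, c_k) *)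
Fixpoint rrseg_zc (k : nat) : H * H :=
  if k is k'.+1 then
    let: (z, c) := rrseg_zc k' in
    let a := rrseg_a k' in
    let y := rrseg_y k' z c in
    let z' := y - eta k' *: (G (zeta k') y + a *: (y - c)
                             - G (xi k') z - a *: (z - c)) in
    (z', (rrseg_a k)^-1 *: (a *: c + lambda k' *: z'))
  else (z0, z0).

Definition rrseg_z (k : nat) : H := (rrseg_zc k).1.

End RRSEG.

Section Schedule.
Context {R : realType}.

Definition ratio_Q (N : nat) : R := (N%:R / 18 + 1) / ln (N%:R / 18).

Definition stepsize (Q L a : R) : R := (3 * (L + Q * a))^-1.

Fixpoint schedule_a (gamma Q L a0 : R) (k : nat) : R :=
  if k is k'.+1 then
    let a := schedule_a gamma Q L a0 k' in
    Num.min L (a / (1 - gamma * stepsize Q L a * a))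
  else a0.

End Schedule.

(* Main.v *)
(** RRSEG is a stochastic extragradient method applied to the moving problems
    [0 \in F x + A x + a_k (x - c_k)], whose solutions [x_k] exist by Minty's
    theorem and Banach's fixed point theorem. Because [a_{k+1} c_{k+1}] absorbs
    [lambda_k z_{k+1}], passing from [x_k] to [x_{k+1}] never moves away from
    [z_{k+1}], so only the contraction of one extragradient step and its noise
    enter the recursion for [E |z_k - x_k|^2]; it yields
    [E |z_k - x_k|^2 <= D^2 (a_0 / a_k)^4 + 5 sigma^2 / (4 (Q + 1) a_k^2)].
    The residual [r_k = a_k (c_k - x_k)] of [x_k] grows by at most
    [lambda_k |z_{k+1} - x_{k+1}|], which is summable against the schedule, and
    [Q] is calibrated so that [a_N = L]. A forward-backward step from [z_N] with
    approximate value [f] for [F z_N] has residual at most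
    [sqrt 2 (|r_N| + sqrt 2 L |z_N - x_N| + |f - F z_N|)]; averaging the last [m]
    oracle values divides their noise by [sqrt m], at the cost of the drift of
    [z_k] over these iterations. *)

Require Import Defs.
From HB Require Import structures.
From mathcomp Require Import all_boot all_order all_algebra.
From mathcomp Require Import all_classical all_reals all_analysis.
From mathcomp Require Import measurable_realfun ring lra.
Import Order.TTheory GRing.Theory Num.Def Num.Theory.
Import numFieldTopology.Exports numFieldNormedType.Exports.

Set Implicit Arguments.
Unset Strict Implicit.
Unset Printing Implicit Defensive.

Local Open Scope classical_set_scope.
Local Open Scope ring_scope.

(** * Inner products and Minty's theorem *)

(** The exponents of the error bound compare two rates. With t = eta_k a_k, one step multiplies the
    squared error by at most 1 - 4 t / 3, while 1 / a_k is multiplied by at least 1 - t / 3. Four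
    powers of 1 / a_k therefore pay for the bias; the noise term spends only two, and the other half
    of the contraction absorbs the new variance, 3/2 eta_k^2 sigma^2 from [xi k] and eta_k^2 sigma^2
    from [zeta k]. The two samples play different roles: [xi k] acts inside the resolvent, so only
    its second moment is used, while [zeta k] enters z_{k+1} affinely and its zero mean removes the
    cross term. Independence enters only through such second moments. Everything after them is a
    pathwise bound, linear in the distances |z_k - x_k| and in the norm of the averaged noise, and
    is integrated by Minkowski's inequality. Since H may be nonseparable, a sum of Borel maps into H
    can fail to be Borel; measurability is carried in the strong form, Borel with separable
    range. *)

Section InnerProduct.
Context {R : realType} {H : completeNormedModType R}.
Variable dot : {dot H for idfun}.
Hypothesis hdot : norm_of_dot dot.

Lemma dotC x y : dot x y = dot y x.
Proof. by rewrite hermC /= expr0 mul1r. Qed.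

Lemma dotDr x y z : dot x (y + z) = dot x y + dot x z.
Proof. exact: raddfD. Qed.

Lemma dotDl x y z : dot (y + z) x = dot y x + dot z x.
Proof. by rewrite dotC dotDr !(dotC x). Qed.

Lemma dotNr x y : dot x (- y) = - dot x y.
Proof. exact: raddfN. Qed.

Lemma dotNl x y : dot (- y) x = - dot y x.
Proof. by rewrite dotC dotNr dotC. Qed.

Lemma dotZr a x y : dot x (a *: y) = a * dot x y.
Proof. by rewrite linearZ. Qed.

Lemma dotZl a x y : dot (a *: y) x = a * dot y x.
Proof. by rewrite dotC dotZr dotC. Qed.

Lemma dot0r x : dot x 0 = 0. Proof. exact: raddf0. Qed.
Lemma dot0l x : dot 0 x = 0. Proof. by rewrite dotC dot0r. Qed.

Definition dotE := (dotDl, dotDr, dotNl, dotNr, dotZl, dotZr).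

Lemma dotxx_ge0 x : 0 <= dot x x.
Proof. by rewrite -hdot exprn_ge0. Qed.

Lemma dot_ext x y : (forall h, dot x h = dot y h) -> x = y.
Proof.
move=> xy; apply/eqP; rewrite -subr_eq0 -normr_eq0 -sqrf_eq0 hdot.
by rewrite {1}dotDl dotNl xy subrr.
Qed.

Lemma dot_le x y : dot x y <= `|x| * `|y|.
Proof.
have [->|x0] := eqVneq x 0; first by rewrite dot0l normr0 mul0r.
have [->|y0] := eqVneq y 0; first by rewrite dot0r normr0 mulr0.
have nx : 0 < `|x| by rewrite normr_gt0.
have ny : 0 < `|y| by rewrite normr_gt0.
have := dotxx_ge0 (`|y| *: x - `|x| *: y).
rewrite !dotE (dotC y x) -!hdot => h.
rewrite -(ler_pM2l (mulr_gt0 nx ny)).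
set s := `|x| in nx h *; set t := `|y| in ny h *.
have : t * (t * s ^+ 2) = (s * t) * (s * t) by ring.
nra.
Qed.

Lemma dot_ge x y : - (`|x| * `|y|) <= dot x y.
Proof. by rewrite lerNl -dotNl -(normrN x); exact: dot_le. Qed.

Lemma dot_cvg (T : Type) (F : set_system T) (FF : Filter F) (f : T -> H) x v :
  f @ F --> x -> (fun t => dot (f t) v) @ F --> dot x v.
Proof.
move=> fx; apply/cvgrPdist_le => e e0.
have n0 : 0 < `|v| + 1 by rewrite ltr_wpDl.
move/cvgrPdist_le : fx => /(_ (e / (`|v| + 1)) (divr_gt0 e0 n0)).
apply: filterS => t; rewrite ler_pdivlMr// => ht.
rewrite -dotNl -dotDl (le_trans _ ht)//.
apply: (@le_trans _ _ (`|x - f t| * `|v|)); last by rewrite ler_wpM2l// lerDl.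
by rewrite ler_norml dot_ge dot_le.
Qed.

End InnerProduct.

(** Linear arithmetic sees [dot x y] and [dot y x] as unrelated atoms; when both occur, one is
    rewritten into the other. The diagonal is skipped, where this would loop. *)
Ltac dot_sym := repeat match goal with |- context [@Dot.sort _ _ _ ?d ?x ?y] =>
  match goal with |- context [@Dot.sort _ _ _ d y x] =>
    tryif constr_eq x y then fail else rewrite (dotC d x y) end end.

(* A linear identity between vectors holds once it holds after pairing with an
   arbitrary vector, where it is a ring or field identity. *)
Ltac vector hdot := match type of hdot with norm_of_dot ?d =>
  apply: (dot_ext hdot) => ?; rewrite ?(dotE d, dot0l d) end.

(** * Minty's theorem by minimising the Fitzpatrick function plus a quadratic *)

Section Minty.
Context {R : realType} {H : completeNormedModType R}.
Variable dot : {dot H for idfun}.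
Hypothesis hdot : norm_of_dot dot.
Variable A : H -> set H.
Hypothesis hA : maximally_monotone dot A.

(** The graph of A with the point (x, u) added is still monotone, so maximality absorbs the
    point. *)
Lemma maximally_monotone_mem x u :
  (forall y v, A y v -> 0 <= dot (u - v) (x - y)) -> A x u.
Proof.
case: hA => mA maxA h.
pose B z w := A z w \/ (z = x /\ w = u).
apply: (maxA B); last by right.
- move=> z w z' w' [Azw|[-> ->]] [Azw'|[-> ->]]; first exact: mA.
  + by rewrite -(opprB u) -(opprB x z) dotNl dotNr opprK; exact: h.
  + exact: h.
  + by rewrite !subrr dot0l.
- by move=> z w Azw; left.
Qed.

Lemma maximally_monotone_nonempty : exists y v, A y v.
Proof.
apply: contrapT => h; apply: (h); exists 0, 0; apply: maximally_monotone_mem => y v Ayv.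
by exfalso; apply: h; exists y, v.
Qed.

(* The function [(x, u) |-> F_A(x, u) + |x|^2/2 + |u|^2/2], with F_A the
   Fitzpatrick function of A, enters only through its epigraph. *)
Let below (x u : H) (t : R) (y v : H) :=
  dot x v + dot y u - dot y v + (`|x| ^+ 2 + `|u| ^+ 2) / 2 <= t.
Let epi (x u : H) (t : R) := forall y v, A y v -> below x u t y v.

(** Strong convexity: F_A is a supremum of affine functions, and the quadratic part gains exactly
    the subtracted term. *)
Let epi_convex x u t x' u' t' (th : R) : 0 <= th <= 1 ->
  epi x u t -> epi x' u' t' ->
  epi (x + th *: (x' - x)) (u + th *: (u' - u))
    (t + th * (t' - t)
     - th * (1 - th) / 2 * (`|x' - x| ^+ 2 + `|u' - u| ^+ 2)).
Proof.
move=> /andP[th0 th1] e e' y v Ayv; have := e _ _ Ayv; have := e' _ _ Ayv.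
rewrite /below !hdot !(dotE dot) (dotC dot x' x) (dotC dot u' u) => h1 h2.
have th1' : 0 <= 1 - th by rewrite subr_ge0.
have := lerD (ler_wpM2l th0 h1) (ler_wpM2l th1' h2).
lra.
Qed.

Let sqr_cauchy (u : nat -> H) (K : R) : 0 < K ->
  (forall n k, (n <= k)%N -> `|u n - u k| ^+ 2 <= K / n.+1%:R) ->
  cvg (u @ \oo).
Proof.
move=> K0 hu; apply: cauchy_cvg; apply: cauchy_exP => e e0.
pose n := Num.truncn (K / e ^+ 2).
have e20 : 0 < e ^+ 2 by rewrite exprn_gt0.
exists (u n); exists n => // k /= nk; rewrite -ball_normE /ball_ /=.
rewrite -(@ltr_pXn2r _ 2)// ?nnegrE ?(ltW e0)//.
apply: le_lt_trans (hu _ _ nk) _.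
rewrite ltr_pdivrMr// mulrC -ltr_pdivrMr//.
exact: truncnS_gt.
Qed.

Let values : set R := [set t | exists x u, epi x u t].

Let values_inf : has_inf values.
Proof.
have [y [v Ayv]] := maximally_monotone_nonempty.
split.
  exists (dot y v + (`|y| ^+ 2 + `|v| ^+ 2) / 2), y, v => z w Azw.
  have := hA.1 _ _ _ _ Ayv Azw.
  by rewrite /below !dotE; dot_sym; lra.
(* Completing the squares in x + v and u + y, in the single inequality for (y, v), leaves this
   constant. *)
exists (- (`|y + v| ^+ 2 / 2)) => t [x [u /(_ _ _ Ayv)]]; rewrite /below.
have := dotxx_ge0 hdot (x + v); have := dotxx_ge0 hdot (u + y).
rewrite !hdot !(dotE dot) (dotC dot v x) (dotC dot y u) (dotC dot v y).
lra.
Qed.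

Let m := inf values.

Let m_le x u t : epi x u t -> m <= t.
Proof. by move=> e; apply: ge_inf; [exact: values_inf.2|exists x, u]. Qed.

(** The value at the midpoint is at least m, which bounds the strong convexity gain there, one
    eighth of the left-hand side. *)
Let epi_close x u t x' u' t' : epi x u t -> epi x' u' t' ->
  `|x' - x| ^+ 2 + `|u' - u| ^+ 2 <= 4 * (t + t' - 2 * m).
Proof.
move=> e e'; have h : 0 <= (1 / 2 : R) <= 1 by lra.
by have := m_le (epi_convex h e e'); lra.
Qed.

(** A minimising sequence with gap 1 / (n + 1) is Cauchy by [epi_close], and each inequality
    defining [epi] passes to the limit. *)
Let epi_min : exists x u, epi x u m.
Proof.
have h n : {p : H * H * R | epi p.1.1 p.1.2 p.2 /\ p.2 < m + n.+1%:R^-1}.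
  apply: cid.
  have n0 : 0 < n.+1%:R^-1 :> R by rewrite invr_gt0.
  by have [t [x [u e]] tm] := inf_adherent n0 values_inf; exists (x, u, t).
pose x n := (sval (h n)).1.1; pose u n := (sval (h n)).1.2.
pose t n := (sval (h n)).2.
have e n : epi (x n) (u n) (t n) by exact: (svalP (h n)).1.
have te n : t n < m + n.+1%:R^-1 by exact: (svalP (h n)).2.
have close n k : (n <= k)%N ->
    `|x n - x k| ^+ 2 + `|u n - u k| ^+ 2 <= 8 / n.+1%:R.
  move=> nk; have := epi_close (e k) (e n).
  have : k.+1%:R^-1 <= n.+1%:R^-1 :> R by rewrite lef_pV2 ?posrE// ler_nat.
  have := te n; have := te k; move: (k.+1%:R^-1) (n.+1%:R^-1) => r r'; lra.
have /cvg_ex[x0 xx0] : cvg (x @ \oo).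
  apply: (@sqr_cauchy _ 8) => // n k /close; apply: le_trans.
  by rewrite lerDl exprn_ge0.
have /cvg_ex[u0 uu0] : cvg (u @ \oo).
  apply: (@sqr_cauchy _ 8) => // n k /close; apply: le_trans.
  by rewrite lerDr exprn_ge0.
exists x0, u0 => y v Ayv; rewrite /below (dotC dot y u0) !expr2.
have := @ler_cvg_to _ \oo _ R (fun n => dot (x n) v + dot (u n) y - dot y v +
  (`|x n| * `|x n| + `|u n| * `|u n|) / 2) (fun n => m + n.+1%:R^-1)
  (dot x0 v + dot u0 y - dot y v + (`|x0| * `|x0| + `|u0| * `|u0|) / 2) m.
apply.
- apply: cvgD.
    apply: cvgB; last exact: cvg_cst.
    by apply: cvgD; apply: (dot_cvg hdot).
  apply: cvgMl; apply: cvgD; apply: cvgM; exact: cvg_norm.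
- rewrite -[X in _ --> X]addr0; apply: cvgD; first exact: cvg_cst.
  exact: cvg_harmonic.
- apply: nearW => n; have := e n _ _ Ayv; rewrite /below (dotC dot y (u n)) -!expr2.
  by move/le_trans; apply; exact: ltW.
Qed.

(* Optimality of the minimiser (x0, u0) gives
   [|x0 + u0|^2 <= dot (v + x0) (y + u0)] on the graph of A, so (-u0, -x0) lies
   on the graph, and testing with it forces u0 = - x0. *)
Theorem minty_zero : exists x, A x (- x).
Proof.
have [x0 [u0 e0]] := epi_min.
(* The Fitzpatrick inequality: a value of F_A below [dot x0 u0] would put (x0, u0) on the graph,
   where testing with that same point gives a contradiction. *)
have mx : dot x0 u0 + (`|x0| ^+ 2 + `|u0| ^+ 2) / 2 <= m.
  rewrite leNgt; apply/negP => lt_m.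
  have Ax0u0 : A x0 u0.
    apply: maximally_monotone_mem => y v Ayv.
    have := e0 _ _ Ayv; move: lt_m; rewrite /below !dotE; dot_sym; lra.
  by have := e0 _ _ Ax0u0; rewrite /below; lra.
have opt y v : A y v -> `|x0 + u0| ^+ 2 <= dot (v + x0) (y + u0).
  move=> Ayv; have e : epi y v (dot y v + (`|y| ^+ 2 + `|v| ^+ 2) / 2).
    move=> z w Azw; have := hA.1 _ _ _ _ Ayv Azw.
    by rewrite /below !dotE; dot_sym; lra.
  set t := (X in epi _ _ X) in e.
  set q := `|y - x0| ^+ 2 + `|v - u0| ^+ 2.
  (* Quadratic growth away from the minimiser, from strong convexity along the segment to (y, v) as
     [th] tends to 0; the choice of [th] keeps the loss th q / 2 below [eps]. *)
  have {e} tq : q / 2 <= t - m.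
    apply/ler_addgt0Pr => eps eps0.
    pose th := minr 1 (2 * eps / (q + 1)).
    have q0 : 0 <= q by rewrite addr_ge0// exprn_ge0.
    have q1 : 0 < q + 1 by rewrite ltr_wpDl.
    have th0 : 0 < th by rewrite lt_min ltr01 divr_gt0// mulr_gt0.
    have th1 : th <= 1 by rewrite ge_min lexx.
    have thq : th * q <= 2 * eps.
      apply: (@le_trans _ _ (th * (q + 1))).
        by apply: ler_wpM2l; [exact: ltW | rewrite lerDl].
      by rewrite -ler_pdivlMr// ge_min lexx orbT.
    have th01 : 0 <= th <= 1 by rewrite ltW.
    have := m_le (epi_convex th01 e0 e); rewrite -/q => h.
    have : 0 <= th * ((t - m) - (1 - th) / 2 * q) by lra.
    by rewrite pmulr_rge0//; lra.
  move: tq mx; rewrite /q /t !hdot !(dotE dot); dot_sym; lra.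
have Ax0 : A (- u0) (- x0).
  apply: maximally_monotone_mem => y v /opt h.
  rewrite -(opprD x0) -(opprD u0) dotNl dotNr opprK (addrC x0) (addrC u0).
  by apply: le_trans h; rewrite exprn_ge0.
have := opt _ _ Ax0; rewrite !addNr dot0l => h.
have {}h : `|x0 + u0| ^+ 2 == 0 by rewrite eq_le h exprn_ge0.
move: h; rewrite expf_eq0 normr_eq0 addr_eq0 => /eqP x0E.
by exists x0; move: Ax0; rewrite -x0E.
Qed.

End Minty.

(** * Geometry of one step *)

Section Geometry.
Context {R : realType} {H : completeNormedModType R}.
Variable dot : {dot H for idfun}.
Hypothesis hdot : norm_of_dot dot.
Implicit Types (p q b d : H) (a t l : R).

Lemma ler_normH p q : dot p p <= dot q q -> `|p| <= `|q|.
Proof. by rewrite -!hdot ler_pXn2r// nnegrE. Qed.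

(** In use, p = y - x, q = z - y, b is the step size times the increment of the regularized operator
    from z to y, and d is the step size times the noise. Inserting the hypothesis on p into the
    expanded square leaves |p + q|^2 - 2 t |p|^2 - |q|^2 + |b - d|^2, whose last term is at most
    |q|^2 / 3 + 3/2 |d|^2. *)
Lemma extragradient_contraction p q b d t : 0 <= t ->
  t * `|p| ^+ 2 <= dot (q + b - d) p -> 3 * `|b| <= `|q| ->
  `|p - b + d| ^+ 2
    <= (1 - 2 * t / (1 + 3 * t)) * `|p + q| ^+ 2 + 3 / 2 * `|d| ^+ 2.
Proof.
move=> t0 hp hb.
have t1 : 0 < 1 + 3 * t by rewrite ltr_pwDl// mulr_ge0.
have hb2 : 9 * `|b| ^+ 2 <= `|q| ^+ 2.
  have -> : 9 * `|b| ^+ 2 = (3 * `|b|) ^+ 2 by ring.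
  by rewrite ler_pXn2r// nnegrE ?mulr_ge0.
have h1 := dotxx_ge0 hdot ((3 * t) *: p - q).
have h2 := dotxx_ge0 hdot (2 *: b + d).
pose k := 2 * t / (1 + 3 * t).
have k0 : 0 <= k by rewrite divr_ge0 ?mulr_ge0// ltW.
(* The constant k is the parallel sum of 2 t and 2/3, the best one here; the slack is a multiple of
   |3 t p - q|^2. *)
have h3 : k * `|p + q| ^+ 2 <= 2 * t * `|p| ^+ 2 + 2 / 3 * `|q| ^+ 2.
  rewrite /k mulrAC ler_pdivrMr//; move: h1; rewrite !hdot !(dotE dot); dot_sym.
  lra.
rewrite -/k mulrBl mul1r.
move: hp hb2 h2 h3; move: (k * _) => K.
by rewrite !hdot !(dotE dot); dot_sym; lra.
Qed.

(** In use, p = z - x' and q = x' - x for consecutive regularized solutions, a is the old weight and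
    l its increment; [l *: p - a *: q] is the change of the residual vector. All three bounds come
    from l dot p q >= a |q|^2. *)
Lemma regularization_step p q a l : 0 < a -> 0 <= l ->
  0 <= dot (l *: p - a *: q) q ->
  [/\ `|p| <= `|p + q|, a * `|q| <= l * `|p| &
      `|l *: p - a *: q| <= l * `|p|].
Proof.
move=> a0 l0; rewrite !(dotE dot) => h.
have pq : 0 <= dot p q.
  have := dotxx_ge0 hdot q => qq.
  have [l00|lp] : l = 0 \/ 0 < l.
    by move: l0; rewrite le_eqVlt => /orP[/eqP <-|]; [left|right].
  - rewrite l00 mul0r add0r oppr_ge0 pmulr_rle0// in h.
    have : `|q| ^+ 2 == 0 by rewrite eq_le hdot h qq.
    by rewrite expf_eq0 normr_eq0 => /eqP ->; rewrite dot0r.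
  - rewrite -(pmulr_rge0 _ lp).
    by have := mulr_ge0 (ltW a0) qq; lra.
split.
- apply: ler_normH; rewrite !(dotE dot) (dotC dot q p).
  by have := dotxx_ge0 hdot q; lra.
- have [->|q0] := eqVneq q 0; first by rewrite normr0 mulr0 mulr_ge0.
  have nq : 0 < `|q| by rewrite normr_gt0.
  rewrite -(ler_pM2r nq) -mulrA -expr2 hdot -mulrA.
  have := dot_le hdot p q => /(ler_wpM2l l0); lra.
- rewrite -[l in X in _ <= X](ger0_norm l0) -normrZ; apply: ler_normH.
  have h' := mulr_ge0 (ltW a0) h; move: h'.
  have := mulr_ge0 (mulr_ge0 (ltW a0) (ltW a0)) (dotxx_ge0 hdot q).
  by rewrite !(dotE dot) (dotC dot q p); lra.
Qed.

Lemma ler_norm_sqrt2 p c : 0 <= c -> `|p| ^+ 2 <= 2 * c ^+ 2 ->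
  `|p| <= Num.sqrt 2 * c.
Proof.
move=> c0 h; rewrite -(@ler_pXn2r _ 2)// ?nnegrE ?mulr_ge0// exprMn sqr_sqrtr//.
Qed.

(* Splitting along p: the components of [mu - p] and [g] in the direction of p
   have opposite signs unless [dot p (mu - p)] is nonnegative, and the negative
   part of the former is at most [`|r|]. *)
Lemma forward_backward_residual p mu r g :
  0 <= dot p (mu - p - r) -> 0 <= dot g p -> `|g| <= `|p| ->
  `|mu - p + g| <= Num.sqrt 2 * (`|r| + `|mu|).
Proof.
move=> hr hg gp; apply: ler_norm_sqrt2; first by rewrite addr_ge0.
have gp2 : dot g g <= dot p p by rewrite -!hdot ler_pXn2r// nnegrE.
(* In the nonnegative case the parallelogram identity for mu - p and g gives the bound 2 |mu|^2
   directly. *)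
have [tp|tp] := leP 0 (dot p (mu - p)).
  apply: (@le_trans _ _ (2 * `|mu| ^+ 2)); last first.
    by rewrite ler_pM2l// ler_pXn2r ?nnegrE ?addr_ge0// lerDr.
  have := dotxx_ge0 hdot (mu - p - g).
  move: gp2 tp; rewrite !hdot !(dotE dot); dot_sym; lra.
have p0 : 0 < `|p|.
  by rewrite normr_gt0; apply: contraTneq tp => ->; rewrite dot0l ltxx.
have [e [pE ee]] : exists e, p = `|p| *: e /\ dot e e = 1.
  exists (`|p|^-1 *: p); split; first by rewrite scalerA divff ?scale1r// gt_eqF.
  by rewrite !(dotE dot) -hdot; field; rewrite gt_eqF.
have n1 : `|e| = 1 by apply/eqP; rewrite -(@eqrXn2 _ 2)// hdot ee expr1n.
pose s := `|p| - dot mu e.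
have sr : s <= `|r|.
  have : 0 <= dot e (mu - p - r).
    by rewrite -(pmulr_rge0 _ p0) -(dotZl dot) -pE.
  have := dot_ge hdot e r.
  by rewrite n1 mul1r [p in mu - p]pE !(dotE dot) ee mulr1 (dotC dot e mu) /s; lra.
have s0 : 0 < s.
  have : dot e (mu - p) < 0 by rewrite -(pmulr_rlt0 _ p0) -(dotZl dot) -pE.
  by rewrite {1}pE !(dotE dot) ee mulr1 (dotC dot e mu) /s; lra.
have sE : `|p| - s = dot mu e by rewrite /s; ring.
clearbody s.
have [w [muE we]] : exists w, mu = w + (`|p| - s) *: e /\ dot w e = 0.
  exists (mu - dot mu e *: e); rewrite sE subrK; split=> //.
  by rewrite !(dotE dot) ee mulr1 subrr.
have muw : `|mu| ^+ 2 = `|w| ^+ 2 + (`|p| - s) ^+ 2.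
  by rewrite {1}muE !hdot !(dotE dot) ee (dotC dot e w) we; ring.
have al0 : 0 <= dot g e by rewrite -(pmulr_rge0 _ p0) -(dotZr dot) -pE.
have [g' [gE ge]] : exists g', g = g' + dot g e *: e /\ dot g' e = 0.
  exists (g - dot g e *: e); rewrite subrK; split=> //.
  by rewrite !(dotE dot) ee mulr1 subrr.
have g'p : `|g'| <= `|p|.
  apply: le_trans gp; apply: ler_normH; rewrite [in X in _ <= X]gE !(dotE dot).
  by rewrite (dotC dot e g') ge ee; have := mulr_ge0 al0 al0; lra.
have wg : dot w g' <= `|w| * `|p|.
  by apply: le_trans (dot_le hdot w g') _; rewrite ler_wpM2l.
(* With g = g' + alpha e, the vector is (w + g') + (alpha - s) e; in the expansion the term -2 s
   alpha is dropped and |g| <= |p| is used. The remaining lines write |p| = (|p| - s) + s. *)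
have G2 : `|mu - p + g| ^+ 2 <= s ^+ 2 + (`|w| + `|p|) ^+ 2.
  have -> : mu - p + g = w - s *: e + g.
    congr (_ + g); rewrite {1}muE {2}pE -addrA -scalerBl -scaleNr.
    by congr (_ + _ *: e); ring.
  have wgE : dot w g = dot w g'.
    by rewrite [in LHS]gE (dotDr dot) (dotZr dot) we mulr0 addr0.
  have := mulr_ge0 (ltW s0) al0.
  move: gp2 wg; rewrite -wgE hdot -(hdot p) !(dotE dot) (dotC dot g w).
  rewrite (dotC dot g e) (dotC dot e w) we ee sqrrD -(hdot w).
  lra.
apply: le_trans G2 _.
have ws : `|w| <= `|mu|.
  by rewrite -(@ler_pXn2r _ 2)// ?nnegrE// muw lerDl sqr_ge0.
have ps : `|p| - s <= `|mu|.
  have [ps0|/ltW ps0] := leP 0 (`|p| - s); last exact: le_trans ps0 _.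
  by rewrite -(@ler_pXn2r _ 2)// ?nnegrE// muw lerDr sqr_ge0.
have wp2 : (`|w| + (`|p| - s)) ^+ 2 <= 2 * `|mu| ^+ 2.
  by have := sqr_ge0 (`|w| - (`|p| - s)); rewrite muw; lra.
apply: (@le_trans _ _ (2 * (s + `|mu|) ^+ 2)); last first.
  by rewrite ler_pM2l// ler_pXn2r ?nnegrE ?addr_ge0 ?(ltW s0)// lerD2r.
have : s * (`|w| + (`|p| - s)) <= s * (`|mu| + `|mu|).
  by rewrite ler_pM2l// lerD.
move: wp2; lra.
Qed.

End Geometry.

(** * Resolvents and regularized solutions *)

Section Operators.
Context {R : realType} {H : completeNormedModType R}.
Variable dot : {dot H for idfun}.
Hypothesis hdot : norm_of_dot dot.
Variable A : H -> set H.
Hypothesis hA : maximally_monotone dot A.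

(** Minty's theorem for y |-> al A(y + x), again maximally monotone; the point y it provides is the
    resolvent of x, minus x. *)
Lemma resolvent_mem (al : R) x : 0 < al ->
  A (resolvent al A x) (al^-1 *: (x - resolvent al A x)).
Proof.
move=> al0; have alN0 : al != 0 by rewrite gt_eqF.
suff [y Ay] : exists y, A y (al^-1 *: (x - y)).
  rewrite /resolvent; case: xgetP => [z _ [u Azu <-]|/(_ y)[]].
    by rewrite addrC addKr scalerA mulVf// scale1r.
  by eexists; first exact: Ay; rewrite scalerA divff// scale1r subrKC.
pose B y := [set w | A (y + x) (al^-1 *: w)].
have hB : maximally_monotone dot B.
  split=> [y w y' w' /= By By'|C mC BC y w Cyw].
    have := hA.1 _ _ _ _ By By'.
    rewrite -scalerBr (dotZl dot) pmulr_rge0 ?invr_gt0//.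
    by rewrite opprD addrACA subrr addr0.
  apply: (maximally_monotone_mem hA) => z v Azv.
  have /(mC _ _ _ _ Cyw) : C (z - x) (al *: v).
    by apply: BC; rewrite /B /= subrK scalerA mulVf// scale1r.
  rewrite -(pmulr_rge0 (dot _ (y + x - z)) al0) -(dotZl dot) scalerBr.
  rewrite scalerA divff// scale1r.
  by rewrite opprB addrCA addrA [x + y]addrC.
have [y By] := minty_zero hdot hB.
by exists (y + x); rewrite opprD addrCA subrr addr0.
Qed.

Lemma resolvent_nonexpansive (al : R) x y : 0 < al ->
  `|resolvent al A x - resolvent al A y| <= `|x - y|.
Proof.
move=> al0; have := hA.1 _ _ _ _ (resolvent_mem x al0) (resolvent_mem y al0).
rewrite -scalerBr (dotZl dot) pmulr_rge0 ?invr_gt0//.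
set p := resolvent _ _ x; set q := resolvent _ _ y => h.
apply: (ler_normH hdot); have := dotxx_ge0 hdot ((x - y) - (p - q)).
by move: h; rewrite !(dotE dot); dot_sym; lra.
Qed.

Variables (F : H -> H) (L : R).
Hypotheses (hFmono : monotone_map dot F) (hFlip : L.-lipschitz F) (L0 : 0 < L).

Lemma lipschitzE x y : `|F x - F y| <= L * `|x - y|.
Proof. exact: hFlip (x, y) (conj I I). Qed.

(* The solution of [0 \in F x + A x + a (x - c)]; it exists and is unique for
   a > 0, so the default value 0 is not used. *)
Definition reg_sol (a : R) (c : H) : H :=
  xget 0 [set x | A x (a *: (c - x) - F x)].

Lemma reg_sol_mem a c : 0 < a ->
  A (reg_sol a c) (a *: (c - reg_sol a c) - F (reg_sol a c)).
Proof.
move=> a0; suff [x Ax] : exists x, A x (a *: (c - x) - F x).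
  by rewrite /reg_sol; case: xgetP => [z _ //|/(_ x)[]].
have La0 : 0 < L + a by rewrite addr_gt0.
(* The map [S] below is a-strongly monotone and (L + a)-Lipschitz, so a forward step of size al has
   squared Lipschitz constant at most 1 - 2 al a + al^2 (L + a)^2; this al minimises it. *)
pose al := a / (L + a) ^+ 2.
have al0 : 0 < al by rewrite divr_gt0 ?exprn_gt0.
pose S x := F x + a *: (x - c).
pose T x := resolvent al A (x - al *: S x).
pose k2 := 1 - a ^+ 2 / (L + a) ^+ 2.
have k21 : k2 < 1 by rewrite ltrBlDr ltrDl divr_gt0// exprn_gt0.
have k20 : 0 <= k2.
  by rewrite subr_ge0 ler_pdivrMr ?exprn_gt0// mul1r ler_pXn2r ?nnegrE ?lerDr// ltW.
have hT x y : `|T x - T y| <= Num.sqrt k2 * `|x - y|.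
  apply: le_trans (resolvent_nonexpansive _ _ al0) _.
  rewrite -(@ler_pXn2r _ 2)// ?nnegrE ?mulr_ge0// exprMn sqr_sqrtr//.
  have hS : `|S x - S y| <= (L + a) * `|x - y|.
    have -> : S x - S y = F x - F y + a *: (x - y).
      by rewrite /S; vector hdot; ring.
    apply: le_trans (ler_normD _ _) _; rewrite mulrDl normrZ gtr0_norm// lerD2r.
    exact: lipschitzE.
  have hS2 : `|S x - S y| ^+ 2 <= (L + a) ^+ 2 * `|x - y| ^+ 2.
    by rewrite -exprMn ler_pXn2r ?nnegrE ?mulr_ge0// ltW.
  have hSm : a * `|x - y| ^+ 2 <= dot (S x - S y) (x - y).
    have -> : S x - S y = F x - F y + a *: (x - y).
      by rewrite /S; vector hdot; ring.
    by rewrite (dotDl dot) (dotZl dot) -hdot lerDr.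
  have -> : x - al *: S x - (y - al *: S y) = (x - y) - al *: (S x - S y).
    by vector hdot; ring.
  have := ler_wpM2l (mulr_ge0 (ltW al0) (ltW al0)) hS2.
  have := ler_wpM2l (ltW al0) hSm.
  have -> : al * al * ((L + a) ^+ 2 * `|x - y| ^+ 2) =
      a ^+ 2 / (L + a) ^+ 2 * `|x - y| ^+ 2.
    by rewrite /al; field; rewrite gt_eqF.
  have -> : al * (a * `|x - y| ^+ 2) = a ^+ 2 / (L + a) ^+ 2 * `|x - y| ^+ 2.
    by rewrite /al; field; rewrite gt_eqF.
  rewrite /k2 mulrBl mul1r; move: (S x - S y) (x - y) (_ / _ * _) => s d K.
  by rewrite !hdot !(dotE dot); dot_sym; lra.
have ctrT : is_contraction (totalfun T : {fun [set: H] >-> [set: H]}).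
  exists (NngNum (sqrtr_ge0 k2)); split=> /=.
    by rewrite -[X in _ < X]sqrtr1 ltr_sqrt.
  by move=> [x y] _; exact: hT.
have [x _ xE] := banach_fixed_point ctrT closedT (ex_intro _ 0 I).
exists x; have := resolvent_mem (x - al *: S x) al0.
rewrite -[resolvent _ _ _]xE addrC addrA addNr add0r scalerN scalerA.
by rewrite mulVf ?gt_eqF// scale1r /S opprD -scalerN opprB addrC.
Qed.

(** [reg_sol a] is the resolvent of F + A with parameter 1 / a. This bound makes x_k strongly
    measurable as a function of c_k. *)
Lemma reg_sol_nonexpansive a c c' : 0 < a ->
  `|reg_sol a c - reg_sol a c'| <= `|c - c'|.
Proof.
move=> a0; have := hA.1 _ _ _ _ (reg_sol_mem c a0) (reg_sol_mem c' a0).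
move: (reg_sol a c) (reg_sol a c') => x x' h; have := hFmono x x'.
rewrite -(pmulr_rge0 _ a0) => h'.
have {h h'} : 0 <= a * dot (c - c' - (x - x')) (x - x').
  have -> : a * dot (c - c' - (x - x')) (x - x') =
    dot (a *: (c - x) - F x - (a *: (c' - x') - F x')) (x - x')
    + dot (F x - F x') (x - x') by rewrite !(dotE dot); ring.
  by rewrite addr_ge0// -(pmulr_rge0 _ a0).
rewrite pmulr_rge0// => h; apply: (ler_normH hdot).
have := dotxx_ge0 hdot (c - c' - (x - x')); move: h.
by move: (c - c') (x - x') => p q; rewrite !(dotE dot); dot_sym; lra.
Qed.

(** Monotonicity makes [dot (c - x) (x - s)] nonnegative. This controls both the initial error and
    the initial residual. *)
Lemma reg_sol_le a c s : 0 < a -> fwd_sum F A s 0 ->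
  `|c - reg_sol a c| <= `|c - s|.
Proof.
move=> a0 [u Asu /eqP]; rewrite addrC addr_eq0 => /eqP uE.
have := hA.1 _ _ _ _ (reg_sol_mem c a0) Asu.
move: (reg_sol a c) => x h; have h' := hFmono x s.
have {h h'} : 0 <= a * dot (c - x) (x - s).
  have -> : a * dot (c - x) (x - s) = dot (a *: (c - x) - F x - u) (x - s)
      + dot (F x - F s) (x - s) by rewrite uE !(dotE dot); ring.
  exact: addr_ge0.
rewrite pmulr_rge0// => h; apply: (ler_normH hdot).
have -> : c - s = (c - x) + (x - s) by rewrite addrA subrK.
have := dotxx_ge0 hdot (x - s); move: h.
by move: (c - x) (x - s) => p q; rewrite !(dotE dot); dot_sym; lra.
Qed.

(** Here d is the noise of the first oracle call only; that of the second is added in expectation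
    later. *)
Lemma extragradient_step (a eta : R) (c z d : H) : 0 < a -> 0 < eta ->
  3 * (eta * (L + a)) <= 1 ->
  let y := resolvent eta A (z - eta *: (F z + d + a *: (z - c))) in
  `|y - eta *: (F y + a *: (y - c) - F z - d - a *: (z - c)) - reg_sol a c| ^+ 2
  <= (1 - 2 * (eta * a) / (1 + 3 * (eta * a))) * `|z - reg_sol a c| ^+ 2
     + 3 / 2 * eta ^+ 2 * `|d| ^+ 2.
Proof.
move=> a0 eta0 etaL /=; set y := resolvent eta A _; set x := reg_sol a c.
have h : 0 <= dot (eta^-1 *: (z - eta *: (F z + d + a *: (z - c)) - y) -
    (a *: (c - x) - F x)) (y - x).
  exact: hA.1 _ _ _ _ (resolvent_mem _ eta0) (reg_sol_mem c a0).
have h' := hFmono y x.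
pose b := eta *: (F y - F z + a *: (y - z)).
have hb : 3 * `|b| <= `|z - y|.
  apply: (@le_trans _ _ (3 * (eta * (L + a)) * `|z - y|)); last first.
    by rewrite -[leRHS]mul1r ler_wpM2r.
  rewrite -!mulrA ler_pM2l// /b normrZ gtr0_norm// ler_pM2l//.
  apply: le_trans (ler_normD _ _) _; rewrite mulrDl normrZ gtr0_norm//.
  by rewrite (distrC z y) lerD2r lipschitzE.
have t0 : 0 <= eta * a by rewrite mulr_ge0// ltW.
have hp : eta * a * `|y - x| ^+ 2 <= dot (z - y + b - eta *: d) (y - x).
  rewrite -subr_ge0.
  have <- : eta * dot (eta^-1 *: (z - eta *: (F z + d + a *: (z - c)) - y) -
              (a *: (c - x) - F x)) (y - x) + eta * dot (F y - F x) (y - x) =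
    dot (z - y + b - eta *: d) (y - x) - eta * a * `|y - x| ^+ 2.
    by rewrite hdot /b !(dotE dot); field; rewrite gt_eqF.
  by rewrite addr_ge0// mulr_ge0// ltW.
have := extragradient_contraction hdot t0 hp hb.
have -> : y - x + (z - y) = z - x by rewrite addrC addrA subrK.
rewrite [ `|eta *: d|]normrZ exprMn (gtr0_norm eta0) !mulrA.
by congr (`|_| ^+ 2 <= _); rewrite /b; vector hdot; ring.
Qed.

Lemma reg_sol_update (a l : R) (c c' z : H) : 0 < a -> 0 <= l ->
  (a + l) *: c' = a *: c + l *: z ->
  let x := reg_sol a c in let x' := reg_sol (a + l) c' in
  [/\ `|z - x'| <= `|z - x|, a * `|x' - x| <= l * `|z - x'| &
      `|(a + l) *: (c' - x')| <= `|a *: (c - x)| + l * `|z - x'|].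
Proof.
move=> a0 l0 cE x x'.
have al0 : 0 < a + l by rewrite ltr_pwDl.
have h : 0 <= dot ((a + l) *: (c' - x') - F x' - (a *: (c - x) - F x)) (x' - x).
  exact: hA.1 _ _ _ _ (reg_sol_mem c' al0) (reg_sol_mem c a0).
have h' := hFmono x' x.
(* The rule for c' is made for this identity: the added weight l is anchored at the new iterate
   z. *)
have xE : (a + l) *: (c' - x') - a *: (c - x) = l *: (z - x') - a *: (x' - x).
  by rewrite scalerBr cE; vector hdot; ring.
have hq : 0 <= dot (l *: (z - x') - a *: (x' - x)) (x' - x).
  rewrite -xE; have -> : dot ((a + l) *: (c' - x') - a *: (c - x)) (x' - x) =
    dot ((a + l) *: (c' - x') - F x' - (a *: (c - x) - F x)) (x' - x)
    + dot (F x' - F x) (x' - x) by rewrite !(dotE dot); ring.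
  exact: addr_ge0.
have [h1 h2 h3] := regularization_step hdot a0 l0 hq.
split=> //; first by move: h1; rewrite subrKA.
by rewrite -[(a + l) *: _](subrK (a *: (c - x))) addrC xE
  (le_trans (ler_normD _ _))// lerD2l.
Qed.

Lemma forward_backward_residual_reg (a : R) (c z f : H) : 0 < a ->
  let x := reg_sol a c in
  let zh := resolvent (1 / L) A (z - (1 / L) *: f) in
  exists2 v, fwd_sum F A zh v &
  `|v| <= Num.sqrt 2 *
     (`|a *: (c - x)| + Num.sqrt 2 * L * `|z - x| + `|f - F z|).
Proof.
move=> a0 x zh; have L10 : 0 < 1 / L by rewrite divr_gt0.
have Azh := resolvent_mem (z - (1 / L) *: f) L10.
pose u := (1 / L)^-1 *: (z - (1 / L) *: f - zh).
have h : 0 <= dot (u - (a *: (c - x) - F x)) (zh - x).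
  exact: hA.1 _ _ _ _ Azh (reg_sol_mem c a0).
have uE : u = L *: (z - zh) - f.
  by rewrite /u; vector hdot; field; rewrite gt_eqF.
exists (F zh + u); first by exists u.
(* Monotonicity and the Lipschitz bound give |h0|^2 <= 2 L^2 |z - x|^2, the origin of the inner sqrt
   2. *)
pose e := f - F z; pose h0 := L *: (z - x) - (F z - F x).
have -> : F zh + u = (h0 - e) - L *: (zh - x) + (F zh - F x).
  by rewrite uE /h0 /e; vector hdot; ring.
apply: le_trans (forward_backward_residual hdot (r := a *: (c - x)) _ _ _) _.
- rewrite (dotZl dot) pmulr_rge0//.
  have -> : h0 - e - L *: (zh - x) - a *: (c - x) = u - (a *: (c - x) - F x).
    by rewrite uE /h0 /e; vector hdot; ring.
  by rewrite (dotC dot).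
- by rewrite (dotZr dot) mulr_ge0// ltW.
- by rewrite normrZ gtr0_norm// lipschitzE.
apply: ler_wpM2l => //; rewrite -[leRHS]addrA lerD2l.
apply: le_trans (ler_normB _ _) _.
rewrite lerD2r -mulrA; apply: ler_norm_sqrt2; first by rewrite mulr_ge0// ltW.
have h1 : `|F z - F x| ^+ 2 <= (L * `|z - x|) ^+ 2.
  by rewrite ler_pXn2r ?nnegrE ?mulr_ge0 ?lipschitzE// ltW.
have h2 := mulr_ge0 (ltW L0) (hFmono z x).
move: h1 h2; rewrite /h0 exprMn; move: (F z - F x) (z - x) => p q.
by rewrite !hdot !(dotE dot); dot_sym; lra.
Qed.

End Operators.

(** * Strong measurability *)

Section StrongMeasurability.
Context {R : realType} {d : measure_display} {T : measurableType d}.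

(** The Borel sigma-algebra of H x H can exceed the product one, so Borel maps alone need not be
    closed under addition; a separable range repairs this. *)
Definition strongly_measurable (V : ptopologicalType) (f : T -> V) : Prop :=
  measurable_fun [set: T] (f : T -> borel V) /\ separable_set (range f).

Lemma closure_small_ball (V : normedModType R) (C : set V) (x : V) (P : set V) :
  closure C x -> nbhs x P -> exists c n,
  [/\ C c, ball c n.+1%:R^-1 x & ball c n.+1%:R^-1 `<=` P].
Proof.
move=> Cx /nbhs_ballP[e /= e0 eP].
pose n := Num.truncn (2 / e).
have ne : n.+1%:R^-1 < e / 2.
  by rewrite -[ltRHS]invrK ltf_pV2 ?posrE ?invr_gt0 ?divr_gt0// invf_div truncnS_gt.
have n0 : 0 < n.+1%:R^-1 :> R by rewrite invr_gt0.
have [c [Cc xc]] := Cx _ (nbhsx_ballx x _ n0).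
exists c, n; split=> //; first exact: ball_sym.
move=> y cy; apply: eP; apply: ball_splitr (le_ball (ltW ne) cy).
by apply: le_ball (ltW ne) _ _; exact: ball_sym.
Qed.

Lemma countable_bigcup_measurable (I : choiceType) (D : set I) (F : I -> set T) :
  countable D -> (forall i, D i -> measurable (F i)) ->
  measurable (\bigcup_(i in D) F i).
Proof.
move=> cD mF; rewrite bigcup_set_type; apply: countable_bigcupT_measurable.
  by rewrite (eq_countable (card_setT _)).
by move=> i; apply: mF; exact: set_valP.
Qed.

(** The preimage of an open set is a countable union of rectangles: the balls have centres in the
    countable dense sets and radii 1 / (n + 1). *)
Lemma strongly_measurable_comp2 (V W : normedModType R) (U : ptopologicalType)
    (h : V * W -> U) (f : T -> V) (g : T -> W) : continuous h ->
  strongly_measurable f -> strongly_measurable g ->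
  strongly_measurable (fun t => h (f t, g t)).
Proof.
move=> ch [mf [C cC fC]] [mg [E cE gE]]; split.
  apply: (@measurability _ _ T (borel U) setT _ (@open U) erefl).
  move=> _ [B oB <-]; rewrite setTI.
  pose good (p : V * W * (nat * nat)) :=
    ball p.1.1 p.2.1.+1%:R^-1 `*` ball p.1.2 p.2.2.+1%:R^-1 `<=` h @^-1` B.
  pose I := [set p | (C `*` E `*` setT) p /\ good p].
  have cI : countable I.
    apply: (@sub_countable _ _ _ (C `*` E `*` setT)).
      by apply: subset_card_le => p [].
    by apply: countableX; [exact: countableX|exact: countableP].
  have -> : (fun t => h (f t, g t)) @^-1` B = \bigcup_(p in I)
      (f @^-1` ball p.1.1 p.2.1.+1%:R^-1 `&` g @^-1` ball p.1.2 p.2.2.+1%:R^-1).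
    apply/seteqP; split=> [t /= Bt|t [p [_ gp] [ft gt]]]; last by apply: gp.
    have : nbhs (f t, g t) (h @^-1` B).
      by apply: ch; exact: open_nbhs_nbhs.
    case=> -[P Q] /= [fP gQ] PQ.
    have [c [n [Cc cft cP]]] := closure_small_ball (fC _ (imageT f t)) fP.
    have [e [k [Ee eft eQ]]] := closure_small_ball (gE _ (imageT g t)) gQ.
    exists ((c, e), (n, k)) => //; split=> // -[x y] [/= /cP Px /eQ Qy].
    exact: PQ.
  apply: countable_bigcup_measurable => // p _; apply: measurableI.
    rewrite -[X in measurable X]setTI; apply: mf => //.
    by apply: sub_sigma_algebra; exact: ball_open.
  rewrite -[X in measurable X]setTI; apply: mg => //.
  by apply: sub_sigma_algebra; exact: ball_open.
exists (h @` (C `*` E)).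
  by apply: (@sub_countable _ _ _ (C `*` E)); [exact: card_image_le|exact: countableX].
move=> _ [t _ <-] N /ch[[P Q] /= [fP gQ] PQ].
have [c [Cc Pc]] := fC _ (imageT f t) _ fP.
have [e [Ee Qe]] := gE _ (imageT g t) _ gQ.
by exists (h (c, e)); split; [exists (c, e)|apply: (PQ (c, e))].
Qed.

Lemma strongly_measurable_comp (V : normedModType R) (U : ptopologicalType)
    (h : V -> U) (f : T -> V) : continuous h ->
  strongly_measurable f -> strongly_measurable (h \o f).
Proof.
move=> ch mf; apply: (@strongly_measurable_comp2 _ _ _ (h \o fst) f f) => //.
by move=> p; apply: continuous_comp; [exact: cvg_fst|exact: ch].
Qed.

Lemma strongly_measurable_cst (U : ptopologicalType) (x : U) :
  strongly_measurable (fun=> x).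
Proof.
split; first exact: measurable_cst.
exists [set x]; first exact: countable1.
by move=> _ [_ _ <-]; exact: subset_closure.
Qed.

Section Vectors.
Context {V : normedModType R}.
Implicit Types f g : T -> V.

Lemma lipschitz_continuous (W : normedModType R) (k : R) (h : V -> W) :
  (forall x y, `|h x - h y| <= k * `|x - y|) -> continuous h.
Proof.
move=> hk x; apply/cvgrPdist_le => e e0; near=> y.
apply: le_trans (hk x y) _; have k0 : 0 < `|k| + 1 by rewrite ltr_wpDl.
apply: (@le_trans _ _ ((`|k| + 1) * `|x - y|)).
  by rewrite ler_wpM2r// (le_trans (ler_norm _))// lerDl.
rewrite mulrC -ler_pdivlMr//; near: y; apply: cvgr_dist_le; first exact: cvg_id.
exact: divr_gt0.
Unshelve. all: by end_near. Qed.

Lemma strongly_measurableD f g : strongly_measurable f ->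
  strongly_measurable g -> strongly_measurable (fun t => f t + g t).
Proof. exact: (strongly_measurable_comp2 (h := fun p => p.1 + p.2)) add_continuous. Qed.

Lemma strongly_measurableZ k f : strongly_measurable f ->
  strongly_measurable (fun t => k *: f t).
Proof.
move=> mf; have ck : continuous (fun x : V => k *: x).
  by apply: (@lipschitz_continuous _ `|k|) => x y; rewrite -scalerBr normrZ.
by have := strongly_measurable_comp ck mf.
Qed.

Lemma strongly_measurableB f g : strongly_measurable f ->
  strongly_measurable g -> strongly_measurable (fun t => f t - g t).
Proof.
move=> mf mg; apply: strongly_measurableD => //.
exact: (@strongly_measurable_comp _ _ -%R g opp_continuous).
Qed.

Lemma strongly_measurable_norm f : strongly_measurable f ->
  measurable_fun [set: T] (fun t => `|f t|).
Proof.
move/(@strongly_measurable_comp _ R (fun x => `|x|) f (@norm_continuous _ V)) => [mf _].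
apply: (measurability _ (RGenOpens.measurableE R)) => _ [_ [x [y ->]] <-].
apply: mf => //; apply: sub_sigma_algebra; exact: interval_open.
Qed.

End Vectors.

Lemma strongly_measurable_precomp (d' : measure_display) (T' : measurableType d')
    (V : ptopologicalType) (f : T -> V) (g : T' -> T) :
  measurable_fun [set: T'] g -> strongly_measurable f ->
  measurable_fun [set: T'] (f \o g : T' -> borel V) /\
  separable_set (range (f \o g)).
Proof.
move=> mg [mf [C cC fC]]; split; first exact: measurableT_comp.
by exists C => // _ [t _ <-]; apply: fC; exists (g t).
Qed.

Lemma strongly_measurable_noise_comp (dXi : measure_display)
    (Xi : measurableType dXi) (H : completeNormedModType R)
    (delta : Xi -> H -> H) (s : T -> Xi) (f : T -> H) :
  strongly_measurable_noise delta -> measurable_fun [set: T] s ->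
  strongly_measurable f -> strongly_measurable (fun t => delta (s t) (f t)).
Proof.
move=> [md sd] ms [mf sf]; split.
  apply: (@measurableT_comp _ _ _ _ _ (borel H)
    (fun p : Xi * borel H => delta p.1 p.2 : borel H) setT (fun t => (s t, f t))) => //.
  exact: measurable_fun_pair.
have [C cC fC] := sd _ sf; exists C => // _ [t _ <-].
by apply: fC; exists (s t), (f t).
Qed.

End StrongMeasurability.

(** * Expectations and fresh samples *)

Section Expectation.
Local Open Scope ereal_scope.
Context {R : realType} {dO : measure_display} {Om : measurableType dO}.
Variable P : probability Om R.

(** The integral of a nonnegative function is a supremum over simple functions below it, hence
    monotone; this applies to the squared residual, whose measurability is not established. *)
Lemma le_integral_ge0 (f g : Om -> \bar R) :
  (forall w, 0 <= f w) -> (forall w, f w <= g w) ->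
  \int[P]_w f w <= \int[P]_w g w.
Proof.
move=> f0 fg; have g0 w : 0 <= g w by exact: le_trans (fg w).
rewrite !ge0_integralTE//; apply: ereal_sup_le.
by move=> _ [h /= hf <-]; exists h => //= w; exact: le_trans (fg w).
Qed.

(** A bound on the L2 norm, stated through the second moment, the form in which the noise estimates
    arrive; [l2_leP] passes to the norm for Minkowski's inequality. *)
Definition l2_le (X : Om -> R) (a : R) : Prop :=
  [/\ measurable_fun [set: Om] X, (0 <= a)%R &
      \int[P]_w ((X w) ^+ 2)%:E <= (a ^+ 2)%:E].

Lemma l2_leP (X : Om -> R) (a : R) : measurable_fun [set: Om] X -> (0 <= a)%R ->
  \int[P]_w ((X w) ^+ 2)%:E <= (a ^+ 2)%:E <-> 'N[P]_2%:E[EFin \o X] <= a%:E.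
Proof.
move=> mX a0; rewrite unlock /= poweR12_sqrt; last first.
  by apply: integral_ge0 => w _; rewrite lee_fin powR_ge0.
have -> : \int[P]_w (`|X w| `^ 2)%:E = \int[P]_w ((X w) ^+ 2)%:E.
  by apply: eq_integral => w _; rewrite powR_mulrn// real_normK// num_real.
have -> : a%:E = sqrte (a ^+ 2)%:E by rewrite /= sqrtr_sqr ger0_norm.
by rewrite lee_sqrt// lee_fin sqr_ge0.
Qed.

Lemma l2_leD (X Y : Om -> R) (a b : R) : l2_le X a -> l2_le Y b ->
  l2_le (fun w => X w + Y w)%R (a + b)%R.
Proof.
move=> [mX a0 hX] [mY b0 hY].
have mXY : measurable_fun [set: Om] (X \+ Y)%R by exact: measurable_funD.
split; [exact: mXY|exact: addr_ge0|].
apply/(l2_leP mXY); first exact: addr_ge0.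
apply: le_trans (minkowski_EFin _ mX mY _) _; first by rewrite ler1n.
by rewrite (EFinD a b); apply: leeD; apply/l2_leP.
Qed.

Lemma l2_le_le (X Y : Om -> R) (a b : R) : measurable_fun [set: Om] Y ->
  (forall w, `|Y w| <= `|X w|)%R -> (a <= b)%R -> l2_le X a -> l2_le Y b.
Proof.
move=> mY YX ab [mX a0 hX]; split=> //; first exact: le_trans ab.
apply: (@le_trans _ _ (\int[P]_w ((X w) ^+ 2)%:E)).
  apply: le_integral_ge0 => w; first by rewrite lee_fin sqr_ge0.
  by rewrite lee_fin -(real_normK (num_real (X w))) -(real_normK (num_real (Y w)))
     ler_pXn2r ?nnegrE.
by apply: le_trans hX _; rewrite lee_fin ler_pXn2r ?nnegrE// (le_trans a0).
Qed.

Lemma l2_leZ (X : Om -> R) (a k : R) : (0 <= k)%R -> l2_le X a ->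
  l2_le (fun w => k * X w)%R (k * a)%R.
Proof.
move=> k0 [mX a0 hX]; split; [exact: measurable_funM|exact: mulr_ge0|].
under eq_integral do rewrite exprMn EFinM.
rewrite ge0_integralZl_EFin//.
- have -> : ((k * a) ^+ 2)%:E = (k ^+ 2)%:E * (a ^+ 2)%:E by rewrite exprMn EFinM.
  by apply: lee_wpmul2l => //; rewrite lee_fin sqr_ge0.
- by move=> w _; rewrite lee_fin sqr_ge0.
- by apply/measurable_EFinP; exact: measurable_funX.
- by rewrite sqr_ge0.
Qed.

Lemma l2_le_cst (a : R) : (0 <= a)%R -> l2_le (fun=> a) a.
Proof.
move=> a0; split=> //; rewrite integral_cst//.
by rewrite [X in _ * X]probability_setT mule1.
Qed.

Lemma l2_le_sum (I : eqType) (r : seq I) (X : I -> Om -> R) (a : I -> R) :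
  (forall i, i \in r -> l2_le (X i) (a i)) ->
  l2_le (fun w => \sum_(i <- r) X i w)%R (\sum_(i <- r) a i)%R.
Proof.
elim: r => [|i r IH] h.
  rewrite big_nil; under [X in l2_le X]eq_fun do rewrite big_nil.
  exact: l2_le_cst.
rewrite big_cons; under [X in l2_le X]eq_fun do rewrite big_cons.
apply: l2_leD; first by apply: h; rewrite mem_head.
by apply: IH => j jr; apply: h; rewrite in_cons jr orbT.
Qed.

End Expectation.

(** * Integrating out a fresh sample *)

Section FreshSample.
Local Open Scope ereal_scope.
Context {R : realType} {dO : measure_display} {Om : measurableType dO}.
Variable P : probability Om R.
Context {dXi : measure_display} {Xi : measurableType dXi}.
Variables (mu : probability Xi R) (X : {RV P >-> Xi}) (G : set (set Om)).
Hypothesis Gm : G `<=` measurable.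
Hypothesis XG : forall B C, measurable B -> <<s G >> C ->
  P (X @^-1` B `&` C) = mu B * P C.

Let OmG : measurableType _ := g_sigma_algebraType G.

Lemma measurable_sub_sigma_algebra (d' : measure_display) (T : measurableType d')
    (f : OmG -> T) :
  measurable_fun [set: OmG] f -> measurable_fun [set: Om] (f : Om -> T).
Proof.
move=> mf _ B mB; rewrite setTI.
apply: (smallest_sub (@sigma_algebra_measurable _ Om) Gm).
by have := mf measurableT B mB; rewrite setTI.
Qed.

(** The identity as a random variable into Om with the smaller sigma-algebra; a function of the past
    is a measurable function on that space. *)
Let idG : Om -> OmG := id.
Let midG : measurable_fun [set: Om] idG.
Proof.
by apply: (@measurable_sub_sigma_algebra _ OmG idfun); exact: measurable_id.
Qed.
HB.instance Definition _ := isMeasurableFun.Build _ _ _ _ idG midG.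

Let XidG : Om -> (Xi * OmG)%type := fun w => (X w, w).
Let mXidG : measurable_fun [set: Om] XidG.
Proof. by apply: measurable_fun_pair => //; exact: midG. Qed.
HB.instance Definition _ := isMeasurableFun.Build _ _ _ _ XidG mXidG.

(** By [XG] the joint law of X and [idG] agrees with the product measure on rectangles, hence
    everywhere, and Tonelli separates the integrals. *)
Lemma fresh_sample_integral (f : Xi * OmG -> \bar R) :
  measurable_fun [set: Xi * OmG] f -> (forall p, 0 <= f p) ->
  \int[P]_w f (X w, w) = \int[P]_w \int[mu]_s f (s, w).
Proof.
move=> mf f0.
have := ge0_integral_distribution (XidG : {RV P >-> (Xi * OmG)%type}) mf f0.
rewrite /comp /= => <-.
rewrite (eq_measure_integral (mu \x distribution P idG)); last first.
  move=> A mA _; symmetry; apply: product_measure_unique => //.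
rewrite fubini_tonelli2// ge0_integral_distribution//.
  exact: measurable_fun_fubini_tonelli_G.
by move=> w; apply: integral_ge0.
Qed.

End FreshSample.

Section FreshNoise.
Local Open Scope ereal_scope.
Context {R : realType} {H : completeNormedModType R}.
Variable dot : {dot H for idfun}.
Hypothesis hdot : norm_of_dot dot.
Context {dXi : measure_display} {Xi : measurableType dXi}.
Variables (mu : probability Xi R) (delta : Xi -> H -> H) (sigma : R).
Hypothesis hdelta : strongly_measurable_noise delta.
Hypothesis hmean : forall z, has_mean dot mu (delta ^~ z) 0%R.
Hypothesis hvar : forall z,
  \int[mu]_s ((`|delta s z| ^+ 2)%:E) <= (sigma ^+ 2)%:E.

Lemma noise_second_moment (v y : H) (eta : R) :
  \int[mu]_s (`|v - eta *: delta s y| ^+ 2)%R%:E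
    <= (`|v| ^+ 2 + eta ^+ 2 * sigma ^+ 2)%R%:E.
Proof.
have mn : measurable_fun [set: Xi] (fun s => `|delta s y|%R).
  apply: strongly_measurable_norm; apply: strongly_measurable_noise_comp => //.
  exact: strongly_measurable_cst.
have id1 : mu.-integrable setT (EFin \o fun s => `|delta s y| ^+ 2)%R.
  apply/integrableP; split; first exact/measurable_EFinP/measurable_funX.
  under eq_integral do rewrite gee0_abs ?lee_fin ?sqr_ge0//.
  by apply: le_lt_trans (hvar y) _; rewrite ltry.
have [id2 ev] := hmean y v.
have icst : mu.-integrable setT (EFin \o cst (`|v| ^+ 2)%R).
  exact: finite_measure_integrable_cst.
have id2' : mu.-integrable setT (fun s => (- (2 * eta))%R%:E * (dot (delta s y) v)%:E).
  exact: integrableZl.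
have id1' : mu.-integrable setT (fun s => (eta ^+ 2)%:E * (`|delta s y| ^+ 2)%:E).
  exact: integrableZl.
have -> : \int[mu]_s (`|v - eta *: delta s y| ^+ 2)%R%:E =
  \int[mu]_s ((`|v| ^+ 2)%:E + ((- (2 * eta))%R%:E * (dot (delta s y) v)%:E
    + (eta ^+ 2)%:E * (`|delta s y| ^+ 2)%:E)).
  apply: eq_integral => s _; rewrite -!EFinM -!EFinD; congr (_%:E).
  by rewrite !hdot !(dotE dot) (dotC dot v (delta s y)); ring.
rewrite integralD//; last exact: integrableD.
rewrite integralD// !integralZl// ev dot0l mule0 add0e EFinD (EFinM (eta ^+ 2)).
rewrite integral_cst// [X in _ * X + _]probability_setT mule1 leeD2l//.
by apply: lee_wpmul2l => //; rewrite lee_fin sqr_ge0.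
Qed.

Context {dO : measure_display} {Om : measurableType dO}.
Variable P : probability Om R.
Variables (X : {RV P >-> Xi}) (G : set (set Om)).
Hypothesis Gm : G `<=` measurable.
Hypothesis XG : forall B C, measurable B -> <<s G >> C ->
  P (X @^-1` B `&` C) = mu B * P C.

Lemma fresh_noise_second_moment (V Y : g_sigma_algebraType G -> H) (eta : R) :
  strongly_measurable V -> strongly_measurable Y ->
  \int[P]_w (`|V w - eta *: delta (X w) (Y w)| ^+ 2)%R%:E
    <= \int[P]_w (`|V w| ^+ 2)%:E + (eta ^+ 2 * sigma ^+ 2)%R%:E.
Proof.
move=> mV mY.
pose f (p : Xi * g_sigma_algebraType G) :=
  (`|V p.2 - eta *: delta p.1 (Y p.2)| ^+ 2)%R%:E.
have mf : measurable_fun setT f.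
  apply/measurable_EFinP/measurable_funX/strongly_measurable_norm.
  apply: strongly_measurableB.
    exact: (strongly_measurable_precomp measurable_snd mV).
  apply/strongly_measurableZ/strongly_measurable_noise_comp => //.
  exact: (strongly_measurable_precomp measurable_snd mY).
have f0 p : 0 <= f p by rewrite lee_fin sqr_ge0.
have := fresh_sample_integral Gm XG mf f0; rewrite /f /= => ->.
apply: (@le_trans _ _ (\int[P]_w ((`|V w| ^+ 2)%:E + (eta ^+ 2 * sigma ^+ 2)%R%:E))).
  apply: le_integral_ge0 => w.
    by apply: integral_ge0 => s _; rewrite lee_fin sqr_ge0.
  exact: noise_second_moment.
rewrite ge0_integralD//.
- by rewrite integral_cst// [X in _ * X]probability_setT mule1.
- apply/measurable_EFinP/measurable_funX.
  apply: (measurable_sub_sigma_algebra (f := fun w => `|V w|%R) Gm).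
  exact: strongly_measurable_norm.
- by move=> w _; rewrite lee_fin mulr_ge0// sqr_ge0.
Qed.

End FreshNoise.

(** * Independence of a sample from the samples drawn earlier *)

Section Filtration.
Local Open Scope ereal_scope.
Context {R : realType} {dXi : measure_display} {Xi : measurableType dXi}.
Variable mu : probability Xi R.
Context {dO : measure_display} {Om : measurableType dO}.
Variable P : probability Om R.
Context {J : finType}.
Variables (X : J -> {RV P >-> Xi}) (time : J -> nat).
Hypothesis hindep : mutually_independent P (fun i => X i : Om -> Xi).
Hypothesis hlaw : forall i B, measurable B -> P (X i @^-1` B) = mu B.

(* A pi-system generating the sigma-algebra of the samples drawn before n. *)
Definition past (n : nat) : set (set Om) :=
  [set C | exists2 B : J -> set Xi,
     forall i, measurable (B i) /\ ((n <= time i)%N -> B i = setT) &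
     C = \bigcap_i (X i @^-1` B i)].

Let measurable_sample i B : measurable B -> measurable (X i @^-1` B).
Proof. by move=> mB; rewrite -[X in measurable X]setTI; exact: measurable_funPT. Qed.

Lemma past_measurable n : past n `<=` measurable.
Proof.
move=> _ [B hB ->]; apply: fin_bigcap_measurable.
  exact: (finite_finset).
by move=> i _; apply: measurable_sample; exact: (hB i).1.
Qed.

Lemma past_setI n : setI_closed (past n).
Proof.
move=> _ _ [B hB ->] [B' hB' ->]; exists (fun i => B i `&` B' i).
  move=> i; have [mB BT] := hB i; have [mB' BT'] := hB' i.
  split; first exact: measurableI.
  by move=> ni; rewrite BT// BT'// setIT.
by rewrite -bigcapI.
Qed.

Lemma past_setT n : past n setT.
Proof.
exists (fun=> setT); first by move=> i; split.
by apply/seteqP; split.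
Qed.

Lemma past_le n n' : (n <= n')%N -> past n `<=` past n'.
Proof.
move=> nn' _ [B hB ->]; exists B => // i; have [mB BT] := hB i; split=> // ni.
by apply: BT; exact: leq_trans ni.
Qed.

Lemma past_sample n i : (time i < n)%N ->
  measurable_fun [set: g_sigma_algebraType (past n)]
    (X i : g_sigma_algebraType (past n) -> Xi).
Proof.
move=> ni _ B mB; rewrite setTI; apply: sub_sigma_algebra.
exists (fun j => if j == i then B else setT).
  by move=> j; case: eqP => [->|_]; split=> //; rewrite leqNgt ni.
apply/seteqP; split=> [w Bw j _ /=|w /(_ i I)/=]; last by rewrite eqxx.
by case: eqP => [->|].
Qed.

(** For fixed B, both sides are finite measures in C, so agreement on the pi-system [past n]
    suffices. *)
Lemma past_independent n i B C : (n <= time i)%N -> measurable B ->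
  <<s past n >> C -> P (X i @^-1` B `&` C) = mu B * P C.
Proof.
move=> ni mB; have mXB := measurable_sample i mB.
have muB : mu B \is a fin_num by exact: fin_num_measure.
pose k : {nonneg R} := NngNum (fine_ge0 (measure_ge0 mu B)).
have kE : k%:num%:E = mu B by rewrite /= fineK.
rewrite -kE setIC; apply: (@g_sigma_algebra_measure_unique _ _ _ (past n)
  (@past_measurable n) (fun=> setT) (fun=> @past_setT n) _
  (mrestr P mXB) (mscale k P)).
- by rewrite bigcup_const.
- exact: past_setI.
- move=> {}C [D hD ->].
  change (P (\bigcap_j (X j @^-1` D j) `&` X i @^-1` B) =
    k%:num%:E * P (\bigcap_j (X j @^-1` D j))); rewrite kE.
  (* The i-th factor of D is [setT], as sample i is not drawn before n, so B can take its place. *)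
  pose D' j := if j == i then B else D j.
  have mD j : measurable (D j) by exact: (hD j).1.
  have -> : \bigcap_j (X j @^-1` D j) `&` X i @^-1` B = \bigcap_j (X j @^-1` D' j).
    apply/seteqP; split=> [w [Dw Bw] j _|w Dw]; rewrite /D' /=.
      by case: eqP => [->|_] //; exact: Dw.
    split=> [j _ /=|]; last by have := Dw i I; rewrite /= /D' eqxx.
    have [->|ji] := eqVneq j i; first by rewrite (hD i).2.
    by have := Dw j I; rewrite /= /D' (negbTE ji).
  rewrite !hindep//; last by move=> j; rewrite /D'; case: ifP.
  rewrite (bigD1 i)//= [in RHS](bigD1 i)//= /D' eqxx (hD i).2// preimage_setT.
  rewrite [X in _ = _ * (X * _)]probability_setT mul1e hlaw//; congr (_ * _).
  by apply: eq_bigr => j /negbTE ->.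
- move=> _.
  exact: le_lt_trans (probability_le1 P (measurableI _ _ measurableT mXB)) (ltry _).
Qed.

End Filtration.

(** * The schedule *)

Section RealBounds.
Context {R : realType}.
Implicit Types x y a b : R.

Lemma ln_ge1V x : 0 < x -> 1 - x^-1 <= ln x.
Proof.
move=> x0; have := le_ln1Dx (x := x^-1 - 1).
rewrite ltrBrDl subrr invr_gt0 x0 => /(_ isT).
by rewrite subrKC lnV ?posrE//; lra.
Qed.

Lemma ln_le_sub1 x : 0 < x -> ln x <= x - 1.
Proof.
move=> x0; have := le_ln1Dx (x := x - 1).
by rewrite ltrBrDl subrr x0 subrKC => /(_ isT).
Qed.

(** For x <= 1/6 the left side is at most 1 - 4 x / 3; Bernoulli's inequality does the rest. The
    base 1 - x / 3 is the factor in the schedule with gamma = 1/3. *)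
Lemma contraction_factor_le x : 0 <= x <= 1 / 6 ->
  1 - 2 * x / (1 + 3 * x) <= (1 - x / 3) ^+ 4.
Proof.
move=> /andP[x0 x6]; have x1 : 0 < 1 + 3 * x by lra.
apply: (@le_trans _ _ (1 - 4 / 3 * x)).
  rewrite lerD2l lerN2 ler_pdivlMr//; nra.
have : 0 <= (x / 3) ^+ 2 * (6 - 4 * (x / 3) + (x / 3) ^+ 2).
  by rewrite mulr_ge0 ?sqr_ge0//; have := sqr_ge0 (x / 3); lra.
lra.
Qed.

(* The choice s^2 = 5 / (4 (Q + 1)) makes the noise term reproduce itself. *)
Lemma error_recursion (Q eta a a' a0 D sigma : R) : 1 <= Q -> 0 < a -> 0 < a' ->
  0 < a0 -> 0 < eta -> eta * a * (Q + 1) <= 1 / 3 ->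
  a' * (1 - eta * a / 3) <= a ->
  let t := eta * a in let S := 5 / (4 * (Q + 1)) in
  (1 - 2 * t / (1 + 3 * t)) * (D ^+ 2 * (a0 / a) ^+ 4 + S * sigma ^+ 2 / a ^+ 2)
    + 5 / 2 * eta ^+ 2 * sigma ^+ 2
  <= D ^+ 2 * (a0 / a') ^+ 4 + S * sigma ^+ 2 / a' ^+ 2.
Proof.
move=> Q1 a_gt0 a'0 a00 eta0 hQ ha' /=; set t := eta * a in hQ ha' *.
set S := 5 / (4 * (Q + 1)).
have Q10 : 0 < Q + 1 by lra.
have t0 : 0 < t by rewrite mulr_gt0.
have t6 : t <= 1 / 6 by nra.
have S0 : 0 < S by rewrite divr_gt0// mulr_gt0.
have t1 : 0 < 1 + 3 * t by lra.
set rho := 1 - 2 * t / (1 + 3 * t).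
have rho0 : 0 <= rho.
  by rewrite subr_ge0 ler_pdivrMr//; lra.
have rho4 : rho <= (1 - t / 3) ^+ 4 by apply: contraction_factor_le; lra.
have inv : (1 - t / 3) / a <= a'^-1.
  by rewrite ler_pdivrMr// [_ * a]mulrC ler_pdivlMr// mulrC.
have u0 : 0 <= (1 - t / 3) / a by rewrite divr_ge0 ?ltW//; lra.
have d1 : rho * (D ^+ 2 * (a0 / a) ^+ 4) <= D ^+ 2 * (a0 / a') ^+ 4.
  apply: (@le_trans _ _ (D ^+ 2 * a0 ^+ 4 * ((1 - t / 3) / a) ^+ 4)).
    have -> : rho * (D ^+ 2 * (a0 / a) ^+ 4) = D ^+ 2 * a0 ^+ 4 * (rho * a^-1 ^+ 4).
      by ring.
    apply: ler_wpM2l; first by rewrite mulr_ge0 ?sqr_ge0 ?exprn_ge0 ?(ltW a00).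
    by rewrite [leRHS]exprMn; apply: ler_wpM2r => //; rewrite exprn_ge0// invr_ge0 ltW.
  have -> : D ^+ 2 * (a0 / a') ^+ 4 = D ^+ 2 * a0 ^+ 4 * a'^-1 ^+ 4 by ring.
  apply: ler_wpM2l.
    by rewrite mulr_ge0 ?sqr_ge0 ?exprn_ge0 ?(ltW a00).
  by rewrite ler_pXn2r// nnegrE invr_ge0 ltW.
have d2 : rho * (S * sigma ^+ 2 / a ^+ 2) + 5 / 2 * eta ^+ 2 * sigma ^+ 2 <=
    S * sigma ^+ 2 / a' ^+ 2.
  (* Half of the contraction 4 t / 3 pays for the new variance, since 5/2 t^2 = 2 S t^2 (Q + 1) <=
     2/3 S t; what remains, 1 - 2 t / 3, is at most (1 - t / 3)^2. *)
  have key : rho * S + 5 / 2 * t ^+ 2 <= S * (1 - t / 3) ^+ 2.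
    have hS : 5 / 2 * t ^+ 2 <= S * (2 / 3 * t).
      have -> : 5 / 2 * t ^+ 2 = S * (2 * (t * (Q + 1)) * t).
        by rewrite /S; field; rewrite gt_eqF.
      by rewrite ler_pM2l// ler_pM2r//; lra.
    apply: le_trans (lerD (lexx _) hS) _; rewrite mulrC -mulrDr ler_pM2l// /rho.
    have : 4 / 3 * t <= 2 * t / (1 + 3 * t) by rewrite ler_pdivlMr//; nra.
    by have := sqr_ge0 (t / 3); lra.
  apply: (@le_trans _ _ (S * sigma ^+ 2 * ((1 - t / 3) / a) ^+ 2)).
    have -> : rho * (S * sigma ^+ 2 / a ^+ 2) + 5 / 2 * eta ^+ 2 * sigma ^+ 2 =
      (rho * S + 5 / 2 * t ^+ 2) * (sigma ^+ 2 / a ^+ 2).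
      by rewrite /t; field; rewrite gt_eqF.
    have -> : S * sigma ^+ 2 * ((1 - t / 3) / a) ^+ 2 =
      S * (1 - t / 3) ^+ 2 * (sigma ^+ 2 / a ^+ 2) by field; rewrite gt_eqF.
    by rewrite ler_wpM2r// divr_ge0// sqr_ge0.
  rewrite -exprVn; apply: ler_wpM2l; first by rewrite mulr_ge0 ?sqr_ge0 ?(ltW S0).
  by rewrite ler_pXn2r// nnegrE invr_ge0 ltW.
by rewrite mulrDr; lra.
Qed.

End RealBounds.

(** * Growth of the regularization weights and numerical bounds *)

Section ScheduleBounds.
Context {R : realType}.
Variables (N : nat) (L : R).
Hypotheses (hN : (19 <= N)%N) (L0 : 0 < L).

Let Q : R := ratio_Q N.
Let t : R := N%:R / 18.
Let a0 : R := 18 * L / N%:R.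
Let a := schedule_a (1 / 3) Q L a0.
Let eta k := stepsize Q L (a k).
Let m := Num.truncn (Num.min Q N%:R).

Let N19 : 19 <= N%:R :> R. Proof. by rewrite ler_nat. Qed.
Let N0 : 0 < N%:R :> R. Proof. by apply: lt_le_trans N19. Qed.
Let t1 : 1 < t. Proof. by rewrite /t; have := N19; lra. Qed.
Let lnt0 : 0 < ln t. Proof. exact: ln_gt0. Qed.
Let a0E : L / a0 = t.
Proof. by rewrite /a0 /t; field; rewrite !gt_eqF. Qed.

Lemma ratio_Q_gt1 : 1 < Q.
Proof.
rewrite /Q /ratio_Q -/t ltr_pdivlMr// mul1r.
by have := @ln_le_sub1 R t (lt_trans ltr01 t1); lra.
Qed.

Let Q1 := ratio_Q_gt1.
Let Q0 : 0 < Q. Proof. exact: lt_trans ltr01 Q1. Qed.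

Lemma truncn_ratio_gt0 : (0 < m)%N.
Proof. by rewrite truncn_gt0 le_min (ltW Q1)/=; have := N19; lra. Qed.

Let min_ge0 : 0 <= Num.min Q N%:R.
Proof. by rewrite le_min ler0n andbT (le_trans ler01)// ltW. Qed.

Let m_le : m%:R <= Num.min Q N%:R.
Proof. by rewrite truncn_le. Qed.

Lemma truncn_ratio_leQ : m%:R <= Q.
Proof. by apply: le_trans m_le _; rewrite ge_min lexx. Qed.

Lemma truncn_ratio_leN : (m <= N)%N.
Proof.
by rewrite -(ler_nat R); apply: le_trans m_le _; rewrite ge_min lexx orbT.
Qed.

Lemma schedule_a_bounds k : 0 < a k <= L.
Proof.
have aS j : a j.+1 = Num.min L (a j / (1 - 1 / 3 * eta j * a j)) by [].
elim: k => [|k /andP[ak0 akL]].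
  rewrite /a /= /a0; apply/andP; split; first by rewrite divr_gt0 ?mulr_gt0.
  by rewrite ler_pdivrMr// [leRHS]mulrC ler_pM2r//; have := N19; lra.
rewrite aS lt_min L0 ge_min lexx andbT /=; apply: divr_gt0 => //.
have D0 : 0 < L + Q * a k by rewrite addr_gt0// mulr_gt0.
rewrite subr_gt0 /eta /stepsize -mulrA.
have -> : 1 / 3 * ((3 * (L + Q * a k))^-1 * a k) = a k / (9 * (L + Q * a k)).
  by field; rewrite gt_eqF.
rewrite ltr_pdivrMr ?mulr_gt0//.
have : 0 < Q * a k by rewrite mulr_gt0.
by have := L0; lra.
Qed.

Lemma schedule_a_gt0 k : 0 < a k. Proof. by case/andP: (schedule_a_bounds k). Qed.
Lemma schedule_a_le k : a k <= L. Proof. by case/andP: (schedule_a_bounds k). Qed.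

Let D0 k : 0 < L + Q * a k.
Proof. by rewrite addr_gt0// mulr_gt0// schedule_a_gt0. Qed.

Lemma stepsize_gt0 k : 0 < eta k.
Proof. by rewrite invr_gt0 mulr_gt0. Qed.

Lemma stepsize_lipschitz k : 3 * (eta k * (L + a k)) <= 1.
Proof.
have -> : 3 * (eta k * (L + a k)) = (L + a k) / (L + Q * a k).
  by rewrite /eta /stepsize; field; rewrite gt_eqF.
by rewrite ler_pdivrMr// mul1r lerD2l ler_pMl ?schedule_a_gt0// ltW.
Qed.

Lemma stepsize_ratio k : eta k * a k * (Q + 1) <= 1 / 3.
Proof.
have -> : eta k * a k * (Q + 1) = (Q + 1) * a k / (3 * (L + Q * a k)).
  by rewrite /eta /stepsize; field; rewrite gt_eqF.
by rewrite ler_pdivrMr ?mulr_gt0//; have := schedule_a_le k; lra.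
Qed.

Lemma stepsize_small k : 0 < eta k * a k <= 1 / 6.
Proof.
have h : 0 < eta k * a k by rewrite mulr_gt0 ?stepsize_gt0 ?schedule_a_gt0.
rewrite h /=; have := stepsize_ratio k; have := Q1 => q.
have : 0 <= eta k * a k * (Q - 1) by rewrite mulr_ge0 ?(ltW h)//; lra.
lra.
Qed.

Lemma schedule_aS k : a k.+1 * (1 - eta k * a k / 3) <= a k.
Proof.
have /andP[h h6] := stepsize_small k.
have p : 0 < 1 - eta k * a k / 3 by lra.
rewrite -ler_pdivlMr// /a /= -/a -/(eta k) ge_min; apply/orP; right.
by rewrite le_eqVlt; apply/orP; left; apply/eqP; congr (_ / _); ring.
Qed.

Lemma schedule_a_incr k : a k <= a k.+1.
Proof.
have /andP[h h6] := stepsize_small k; have ak := schedule_a_gt0 k.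
rewrite /a /= -/a -/(eta k) le_min schedule_a_le /=.
by rewrite ler_pdivlMr ?ler_piMr ?ltW//; lra.
Qed.

(* The potential 9 (u - 1 + Q ln u), u = L / a_k, starts at N and decreases by
   at least one per step until a_k reaches L. *)
Lemma schedule_a_last : a N = L.
Proof.
suff h k : a k = L \/ 9 * (L / a k - 1 + Q * ln (L / a k)) + k%:R <= N%:R.
  have [//|hN'] := h N; apply/eqP; rewrite eq_le schedule_a_le /=.
  have aN := schedule_a_gt0 N.
  have u1 : 1 <= L / a N by rewrite ler_pdivlMr// mul1r schedule_a_le.
  have : 0 <= Q * ln (L / a N) by rewrite mulr_ge0 ?ln_ge0// (le_trans ler01)// ltW.
  have [u2 _|] := leP (L / a N) 1; last by lra.
  by rewrite -[leRHS]mul1r -ler_pdivrMr.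
elim: k => [|k [akL|IH]].
- right; rewrite [a 0%N]/= a0E addr0.
  (* The definition of Q makes the initial potential 9 (t - 1 + t + 1) = 18 t = N. *)
  have -> : Q * ln t = t + 1 by rewrite /Q /ratio_Q -/t divfK// gt_eqF.
  by rewrite /t; lra.
- by left; apply/eqP; rewrite eq_le schedule_a_le -akL schedule_a_incr.
have [Lle|lt] := leP L (a k / (1 - 1 / 3 * eta k * a k)).
  by left; rewrite /a /= -/a -/(eta k) min_l.
right; rewrite /a /= -/a -/(eta k) min_r ?(ltW lt)//.
have /andP[h h6] := stepsize_small k; have ak := schedule_a_gt0 k.
set x := 1 / 3 * eta k * a k; have p : 0 < 1 - x by rewrite /x; lra.
have -> : L / (a k / (1 - x)) = L / a k * (1 - x).
  by field; rewrite !gt_eqF.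
have u0 : 0 < L / a k by rewrite divr_gt0.
rewrite lnM ?posrE//.
have lnx : ln (1 - x) <= - x by have := ln_le_sub1 p; lra.
(* As x = a_k / (9 (L + Q a_k)), the potential drops by exactly 1 once ln (1 - x) is replaced by its
   upper bound -x. *)
have e : 9 * (L / a k * x + Q * x) = 1.
  by rewrite /x /eta /stepsize; field; rewrite !gt_eqF.
have := ler_wpM2l (le_trans ler01 (ltW Q1)) lnx.
by rewrite -natr1; lra.
Qed.

(** Going back from a_N = L, each step multiplies L / a_k by at most 1 / (1 - r); by Bernoulli's
    inequality m <= Q steps cost m r <= 1/9. *)
Lemma schedule_a_tail k : (N - m <= k <= N)%N -> L / a k <= 9 / 8.
Proof.
move=> /andP[mk kN].
have Q10 : 0 < Q + 1 by have := Q1; lra.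
pose r := (9 * (Q + 1))^-1.
have rQ : r * (9 * (Q + 1)) = 1 by rewrite mulVf// gt_eqF// mulr_gt0.
have r0 : 0 < r by rewrite invr_gt0 mulr_gt0.
have jm j : (j <= m)%N -> j%:R * r <= 1 / 9.
  move=> jlem; have : j%:R <= Q by apply: le_trans truncn_ratio_leQ; rewrite ler_nat.
  move=> jQ; have := ler_wpM2r (ltW r0) jQ; lra.
have step j : L / a j * (1 - r) <= L / a j.+1.
  have aj := schedule_a_gt0 j; have aj1 := schedule_a_gt0 j.+1.
  rewrite ler_pdivlMr//.
  have -> : L / a j * (1 - r) * a j.+1 = L * (a j.+1 * (1 - r) / a j) by ring.
  rewrite ger_pMr// ler_pdivrMr// mul1r.
  apply: le_trans (schedule_aS j); rewrite ler_pM2l// lerD2l lerN2.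
  have := ler_wpM2r (ltW r0) (stepsize_ratio j).
  have -> : eta j * a j * (Q + 1) * r = eta j * a j * (r * (9 * (Q + 1))) / 9 by field.
  by rewrite rQ; lra.
have h j : (j <= m)%N -> L / a (N - j) * (1 - j%:R * r) <= 1.
  elim: j => [_|j IH jlem].
    by rewrite subn0 schedule_a_last divff ?gt_eqF// mul0r subr0 mulr1.
  have jN : (j < N)%N by apply: leq_trans jlem truncn_ratio_leN.
  have e : (N - j = (N - j.+1).+1)%N by rewrite subnSK.
  have s := step (N - j.+1)%N; rewrite -e in s.
  apply: le_trans (IH (ltnW jlem)).
  have u0 : 0 < L / a (N - j.+1) by rewrite divr_gt0// schedule_a_gt0.
  have j1 := jm _ (ltnW jlem).
  have jr0 : 0 <= 1 - j%:R * r by lra.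
  apply: le_trans (ler_wpM2r jr0 s).
  rewrite -[leRHS]mulrA ler_pM2l// -natr1.
  have : 0 <= r * (j%:R * r) by rewrite !mulr_ge0// ltW.
  lra.
have km : (N - k <= m)%N by rewrite leq_subLR addnC -leq_subLR.
have := h _ km; have := jm _ km; rewrite subKn//.
have : 0 < L / a k by rewrite divr_gt0// schedule_a_gt0.
set u := L / a k; set w := _ * r => u0 w9 uw.
have : u * (8 / 9) <= u * (1 - w) by rewrite ler_pM2l//; lra.
lra.
Qed.

Let a_ := schedule_a_gt0.

Lemma schedule_increment k :
  (a k.+1 - a k) / (a k * a k.+1) = (a k)^-1 - (a k.+1)^-1.
Proof. by field; rewrite !gt_eqF. Qed.

Lemma schedule_sum_invX2 :
  \sum_(0 <= k < N) (a k.+1 - a k) / a k.+1 ^+ 2 <= a0^-1 - L^-1.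
Proof.
have -> : a0^-1 - L^-1 = \sum_(0 <= k < N) ((- (a k.+1)^-1) - (- (a k)^-1)).
  by rewrite (telescope_sumr (fun k => - (a k)^-1))// schedule_a_last opprK addrC.
apply: ler_sum_nat => k _; rewrite opprK [leRHS]addrC -schedule_increment.
have ak := a_ k; have ak1 := a_ k.+1.
rewrite ler_wpM2l ?subr_ge0 ?schedule_a_incr// expr2.
by rewrite lef_pV2 ?posrE ?mulr_gt0// ler_pM2r// schedule_a_incr.
Qed.

(** Each summand is at most ln (a_{k+1} / a_k), by ln u >= 1 - 1 / u. *)
Lemma schedule_sum_inv :
  \sum_(0 <= k < N) (a k.+1 - a k) / a k.+1 <= ln t.
Proof.
have -> : ln t = \sum_(0 <= k < N) (ln (a k.+1) - ln (a k)).
  rewrite (telescope_sumr (fun k => ln (a k)))// schedule_a_last -a0E ln_div//.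
  by rewrite posrE (a_ 0).
apply: ler_sum_nat => k _; have ak := a_ k; have ak1 := a_ k.+1.
rewrite -ln_div ?posrE//; apply: le_trans (ln_ge1V _); last exact: divr_gt0.
by rewrite invf_div mulrBl divff// gt_eqF.
Qed.

Let tail_inv k : (N - m <= k <= N)%N -> (a k)^-1 - L^-1 <= (8 * L)^-1.
Proof.
move=> /schedule_a_tail h; have ak := a_ k.
rewrite -(ler_pM2l L0) mulrBr divff ?gt_eqF//.
have -> : L * (8 * L)^-1 = 1 / 8 by field; rewrite gt_eqF.
by lra.
Qed.

Lemma schedule_tail_sum_inv k : (N - m <= k <= N)%N ->
  \sum_(k <= j < N) (a j.+1 - a j) / (a j * a j.+1) <= (8 * L)^-1.
Proof.
move=> mkN; have /andP[mk kN] := mkN; apply: le_trans (tail_inv mkN).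
have -> : (a k)^-1 - L^-1 = \sum_(k <= j < N) ((- (a j.+1)^-1) - (- (a j)^-1)).
  by rewrite (telescope_sumr (fun k => - (a k)^-1))// schedule_a_last opprK addrC.
by apply: ler_sum_nat => j _; rewrite opprK [leRHS]addrC schedule_increment.
Qed.

(** The 9/64 is 9/8, from 1 / a_{j+1} <= 9 / (8 L), times 1/8 from the telescoping tail. *)
Lemma schedule_tail_sum_invX2 k : (N - m <= k <= N)%N ->
  \sum_(k <= j < N) (a j.+1 - a j) / (a j * a j.+1 ^+ 2) <= 9 / (64 * L ^+ 2).
Proof.
move=> mkN; have /andP[mk kN] := mkN.
apply: (@le_trans _ _ (9 / (8 * L) *
    \sum_(k <= j < N) (a j.+1 - a j) / (a j * a j.+1))); last first.
  have -> : 9 / (64 * L ^+ 2) = 9 / (8 * L) * (8 * L)^-1 by field; rewrite gt_eqF.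
  by rewrite ler_wpM2l ?schedule_tail_sum_inv// divr_ge0// mulr_ge0// ltW.
rewrite mulr_sumr; apply: ler_sum_nat => j /andP[kj jN].
have aj := a_ j; have aj1 := a_ j.+1.
have -> : (a j.+1 - a j) / (a j * a j.+1 ^+ 2) =
  (a j.+1)^-1 * ((a j.+1 - a j) / (a j * a j.+1)) by field; rewrite !gt_eqF.
apply: ler_wpM2r.
  by rewrite divr_ge0 ?subr_ge0 ?schedule_a_incr// mulr_ge0// ltW.
have : L / a j.+1 <= 9 / 8.
  by apply: schedule_a_tail; rewrite jN andbT (leq_trans mk)// (leq_trans kj).
rewrite ler_pdivrMr// => h; rewrite ler_pdivlMr ?mulr_gt0// ler_pdivrMl//.
by lra.
Qed.

Lemma ln_N_ge2 : 2 <= ln (N%:R : R).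
Proof.
apply: (@le_trans _ _ (ln (2 ^+ 4))).
  by rewrite lnXn//; have := @ln_ge1V R 2 (ltr0n _ _); lra.
by rewrite ler_ln ?posrE ?exprn_gt0//; have := N19; lra.
Qed.

Let ln_t_le : ln t <= ln (N%:R : R).
Proof.
have := N0; have := t1 => ? ?; rewrite ler_ln ?posrE//; last by lra.
by rewrite /t; lra.
Qed.

Lemma ratio_Q_inv : Q^-1 <= 18 * ln (N%:R : R) / N%:R.
Proof.
have t0 : 0 < t by apply: lt_trans t1.
rewrite /Q /ratio_Q -/t invf_div ler_pdivrMr ?addr_gt0//.
have -> : 18 * ln N%:R / N%:R * (t + 1) = ln N%:R + 18 * ln N%:R / N%:R.
  by rewrite /t; field; rewrite gt_eqF.
apply: le_trans ln_t_le _; rewrite lerDl divr_ge0// mulr_ge0//.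
by have := ln_N_ge2; lra.
Qed.

(** As m >= 1, rounding down loses at most a factor 2, so 1 / m is at most 2 / Q or 2 / N. *)
Lemma truncn_ratio_inv : (m%:R)^-1 <= 38 * ln (N%:R : R) ^+ 3 / N%:R.
Proof.
have m0 : 0 < m%:R :> R by rewrite ltr0n truncn_ratio_gt0.
have mN : Num.min Q N%:R <= 2 * m%:R.
  have /andP[_ h] := truncn_itv min_ge0; rewrite -/m in h.
  have : 1 <= m%:R :> R by rewrite ler1n truncn_ratio_gt0.
  by move: h; rewrite -natr1; lra.
have [l2 Qi] := (ln_N_ge2, ratio_Q_inv).
have l3 : ln (N%:R : R) <= ln (N%:R : R) ^+ 3 /\ 1 <= ln (N%:R : R) ^+ 3.
  set l := ln _ in l2 *.
  have l1 : 1 <= l ^+ 2 by rewrite exprn_ege1//; lra.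
  have -> : l ^+ 3 = l * l ^+ 2 by ring.
  by split; nra.
have h (x : R) : 0 < x -> x <= 2 * m%:R -> (m%:R : R)^-1 <= 2 * x^-1.
  by move=> x0 xm; rewrite ler_pdivlMr// mulrC ler_pdivrMr.
have [l31 l32] := l3.
move: mN; rewrite ge_min => /orP[/(h _ Q0)|/(h _ N0)] hm; apply: le_trans hm _.
  apply: le_trans (ler_wpM2l (ler0n _ 2) Qi) _.
  by rewrite mulrA ler_pM2r ?invr_gt0//; lra.
by rewrite ler_pM2r ?invr_gt0//; lra.
Qed.

(** The square of X + Y + Z is at most three times the sum of squares. Here 131 = 54 + 77 bounds the
    bias X, while 76 + 1125 = 1201 bounds the two noise terms and is less than 131^2. *)
Lemma rate_bound (D sigma : R) : 0 < D -> 0 <= sigma ->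
  (36 * Num.sqrt 2 * L * D / N%:R
   + 324 * Num.sqrt 2 * L * D / N%:R ^+ 2 * (Num.sqrt 2 - 1 + 77 / 32)
   + Num.sqrt 2 * sigma / Num.sqrt m%:R
   + sigma * Num.sqrt (5 / (2 * (Q + 1))) * (ln t + Num.sqrt 2 + 9 / 4)) ^+ 2
  <= 3 * 131 ^+ 2 * (L ^+ 2 * D ^+ 2 / N%:R ^+ 2
              + sigma ^+ 2 * ln N%:R ^+ 3 / N%:R).
Proof.
move=> D0' s0; set r2 := Num.sqrt 2.
have r20 : 0 <= r2 by exact: sqrtr_ge0.
have r22 : r2 ^+ 2 = 2 by rewrite sqr_sqrtr.
have r23 : r2 <= 3 / 2 by nra.
have r21 : 1 <= r2 by nra.
set X := 36 * r2 * L * D / _ + _.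
set Y := r2 * sigma / _; set Z := sigma * _ * _.
set U := L * D / N%:R; set l := ln (N%:R : R).
have U0 : 0 <= U by rewrite divr_ge0 ?mulr_ge0// ltW.
have l2 : 2 <= l := ln_N_ge2.
have XE : X = (36 * r2 + 324 * r2 * (r2 - 1 + 77 / 32) / N%:R) * U.
  by rewrite /X /U; field; rewrite gt_eqF.
have k0 : 0 <= 324 * r2 * (r2 - 1 + 77 / 32) / N%:R.
  apply: divr_ge0; last exact: ltW.
  have : 0 <= r2 * (r2 - 1 + 77 / 32) by apply: mulr_ge0 => //; lra.
  by lra.
have X0 : 0 <= X.
  by rewrite XE; apply: mulr_ge0; last exact: U0; move: k0; set k := _ / N%:R; lra.
have XU : X <= 131 * U.
  rewrite XE; apply: ler_wpM2r => //.
  have : 324 * r2 * (r2 - 1 + 77 / 32) / N%:R <= 77.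
    by rewrite ler_pdivrMr//; have := N19; nra.
  by lra.
have X2 : X ^+ 2 <= 131 ^+ 2 * (L ^+ 2 * D ^+ 2 / N%:R ^+ 2).
  have -> : 131 ^+ 2 * (L ^+ 2 * D ^+ 2 / N%:R ^+ 2) = (131 * U) ^+ 2.
    by rewrite /U; field; rewrite gt_eqF.
  by rewrite ler_pXn2r// nnegrE// mulr_ge0.
have Y2 : Y ^+ 2 <= 76 * (sigma ^+ 2 * l ^+ 3 / N%:R).
  have -> : Y ^+ 2 = 2 * sigma ^+ 2 * m%:R^-1.
    by rewrite /Y !exprMn r22 exprVn sqr_sqrtr.
  have -> : 76 * (sigma ^+ 2 * l ^+ 3 / N%:R) = 2 * sigma ^+ 2 * (38 * l ^+ 3 / N%:R).
    by field; rewrite gt_eqF.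
  by apply: ler_wpM2l truncn_ratio_inv; rewrite mulr_ge0// sqr_ge0.
have Z2 : Z ^+ 2 <= 1125 * (sigma ^+ 2 * l ^+ 3 / N%:R).
  have Q10 : 0 < Q + 1 by have := Q1; lra.
  have S0 : 0 <= 5 / (2 * (Q + 1)) by rewrite divr_ge0// mulr_ge0// ltW.
  rewrite /Z !exprMn sqr_sqrtr//.
  have hS : 5 / (2 * (Q + 1)) <= 45 * l / N%:R.
    apply: (@le_trans _ _ (5 / 2 * Q^-1)); last first.
      have -> : 45 * l / N%:R = 5 / 2 * (18 * l / N%:R) by field; rewrite gt_eqF.
      by apply: ler_wpM2l ratio_Q_inv; rewrite divr_ge0.
    rewrite invfM mulrA; apply: ler_wpM2l; first by rewrite divr_ge0.
    by rewrite lef_pV2 ?posrE// lerDl.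
  have hl : (ln t + r2 + 9 / 4) ^+ 2 <= (5 * l) ^+ 2.
    have := ltW lnt0; have := ln_t_le; rewrite -/l => tl t0.
    by rewrite ler_pXn2r// ?nnegrE; lra.
  have -> : 1125 * (sigma ^+ 2 * l ^+ 3 / N%:R) =
    sigma ^+ 2 * (45 * l / N%:R) * (5 * l) ^+ 2 by field; rewrite gt_eqF.
  apply: ler_pM => //; rewrite ?sqr_ge0//; first by rewrite mulr_ge0// sqr_ge0.
  by apply: ler_wpM2l => //; exact: sqr_ge0.
have P1 : 0 <= L ^+ 2 * D ^+ 2 / N%:R ^+ 2.
  by apply: divr_ge0; [apply: mulr_ge0|]; exact: sqr_ge0.
have P2 : 0 <= sigma ^+ 2 * l ^+ 3 / N%:R.
  by rewrite divr_ge0// mulr_ge0 ?sqr_ge0// exprn_ge0//; lra.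
have := sqr_ge0 (X - Y); have := sqr_ge0 (X - Z); have := sqr_ge0 (Y - Z).
move: X2 Y2 Z2 P1 P2; clearbody X Y Z.
move: (L ^+ 2 * _ / _) (_ / N%:R) => p q.
have : 1201 <= 131 ^+ 2 :> R by lra.
move: (131 ^+ 2) => K K0 X2 Y2 Z2 p0 q0.
have : 0 <= (K - 1201) * q by apply: mulr_ge0; rewrite ?subr_ge0.
by lra.
Qed.

End ScheduleBounds.

(** * The stochastic process *)

Section Process.
Context {R : realType} {H : completeNormedModType R}.
Variable dot : {dot H for idfun}.
Hypothesis hdot : norm_of_dot dot.
Variables (L D sigma : R).
Hypotheses (L0 : 0 < L) (D0 : 0 < D) (sigma0 : 0 <= sigma).
Variable F : H -> H.
Hypotheses (hFmono : monotone_map dot F) (hFlip : L.-lipschitz F).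
Variable A : H -> set H.
Hypothesis hA : maximally_monotone dot A.
Variables (z0 zstar : H).
Hypotheses (hzstar : fwd_sum F A zstar 0) (hD : `|z0 - zstar| <= D).
Context {dXi : measure_display} {Xi : measurableType dXi}.
Variables (mu : probability Xi R) (delta : Xi -> H -> H).
Hypothesis hdelta : strongly_measurable_noise delta.
Hypothesis hmean : forall z, has_mean dot mu (delta ^~ z) 0.
Hypothesis hvar : forall z,
  (\int[mu]_s ((`|delta s z| ^+ 2)%:E) <= (sigma ^+ 2)%:E)%E.
Variable N : nat.
Context {dO : measure_display} {Om : measurableType dO}.
Variables (P : probability Om R) (xi zeta : nat -> {RV P >-> Xi}).
Hypothesis hxi : forall k, (k < N)%N -> forall B, measurable B ->
  distribution P (xi k) B = mu B.
Hypothesis hzeta : forall k, (k < N)%N -> forall B, measurable B ->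
  distribution P (zeta k) B = mu B.
Hypothesis hindep : mutually_independent P
  (fun i => samples (N := N) xi zeta i : Om -> Xi).

Variables (Q : R) (a eta : nat -> R).
Hypotheses (Q1 : 1 <= Q) (a_gt0 : forall k, 0 < a k)
  (a_incr : forall k, a k <= a k.+1) (eta_gt0 : forall k, 0 < eta k)
  (eta_lip : forall k, 3 * (eta k * (L + a k)) <= 1)
  (eta_ratio : forall k, eta k * a k * (Q + 1) <= 1 / 3)
  (aS : forall k, a k.+1 * (1 - eta k * a k / 3) <= a k).

Variables z c y : nat -> Om -> H.
Hypothesis z_0 : forall w, z 0 w = z0.
Hypothesis c_0 : forall w, c 0 w = z0.
Hypothesis yE : forall k w, y k w = resolvent (eta k) A
  (z k w - eta k *: (F (z k w) + delta (xi k w) (z k w) + a k *: (z k w - c k w))).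
Hypothesis zS : forall k w, z k.+1 w = y k w - eta k *:
  (F (y k w) + delta (zeta k w) (y k w) + a k *: (y k w - c k w)
   - (F (z k w) + delta (xi k w) (z k w)) - a k *: (z k w - c k w)).
Hypothesis cS : forall k w,
  c k.+1 w = (a k.+1)^-1 *: (a k *: c k w + (a k.+1 - a k) *: z k.+1 w).

(** Drawing order: z_k and c_k are known before time 2k, when [xi k] is drawn, and y_k before time
    2k + 1, when [zeta k] is drawn. *)
Let time (i : 'I_N + 'I_N) : nat :=
  match i with inl k => k.*2 | inr k => k.*2.+1 end.
Let X (i : 'I_N + 'I_N) : {RV P >-> Xi} := samples xi zeta i.
Let law i B : measurable B -> P (X i @^-1` B) = mu B.
Proof. by case: i => k mB; [exact: hxi|exact: hzeta]. Qed.
Let pastOm n : measurableType _ := g_sigma_algebraType (past X time n).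

Let smeas (n : nat) (f : Om -> H) := @strongly_measurable _ (pastOm n) H f.

Let smeas_le n n' f : (n <= n')%N -> smeas n f -> smeas n' f.
Proof.
move=> nn' [mf sf]; split=> // _ B mB; rewrite setTI.
have := mf measurableT B mB; rewrite setTI.
by apply: sub_sigma_algebra2; exact: past_le.
Qed.

Let smeas_norm n f : smeas n f -> measurable_fun [set: Om] (fun w => `|f w|).
Proof.
move=> /strongly_measurable_norm.
exact: (measurable_sub_sigma_algebra (f := fun w => `|f w|) (past_measurable (n := n))).
Qed.

Let smeas_lip n (k : R) (h : H -> H) f : (forall x x', `|h x - h x'| <= k * `|x - x'|) ->
  smeas n f -> smeas n (fun w => h (f w)).
Proof.
move=> hk mf; have ch : continuous h by exact: lipschitz_continuous hk.
by have := strongly_measurable_comp ch mf.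
Qed.

Let smeas_noise n i f : (time i < n)%N -> smeas n f ->
  smeas n (fun w => delta (X i w) (f w)).
Proof.
by move=> ni; apply: strongly_measurable_noise_comp => //; exact: past_sample.
Qed.

Let fresh n i f g (e : R) : (n <= time i)%N -> smeas n f -> smeas n g ->
  (\int[P]_w (`|f w - e *: delta (X i w) (g w)| ^+ 2)%R%:E
    <= \int[P]_w (`|f w| ^+ 2)%:E + (e ^+ 2 * sigma ^+ 2)%R%:E)%E.
Proof.
move=> ni mf mg.
apply: (@fresh_noise_second_moment _ _ _ hdot _ _ _ _ _ hdelta hmean hvar _ _ _ _
  (past X time n)) => //; first exact: past_measurable.
by move=> B C mB; exact: (past_independent hindep law).
Qed.

Let smeasF n f : smeas n f -> smeas n (fun w => F (f w)).
Proof. by apply: (@smeas_lip _ L) => x x'; exact: lipschitzE. Qed.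

Let smeas_xi n k f : (k < N)%N -> (k.*2 < n)%N -> smeas n f ->
  smeas n (fun w => delta (xi k w) (f w)).
Proof. by move=> kN; exact: (@smeas_noise n (inl (Ordinal kN))). Qed.

Let smeas_zeta n k f : (k < N)%N -> (k.*2.+1 < n)%N -> smeas n f ->
  smeas n (fun w => delta (zeta k w) (f w)).
Proof. by move=> kN; exact: (@smeas_noise n (inr (Ordinal kN))). Qed.

Let smeasD n f g : smeas n f -> smeas n g -> smeas n (fun w => f w + g w).
Proof. exact: strongly_measurableD. Qed.
Let smeasB n f g : smeas n f -> smeas n g -> smeas n (fun w => f w - g w).
Proof. exact: strongly_measurableB. Qed.
Let smeasZ n e f : smeas n f -> smeas n (fun w => e *: f w).
Proof. exact: strongly_measurableZ. Qed.
Let smeas_cst n (x : H) : smeas n (fun=> x).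
Proof. exact: strongly_measurable_cst. Qed.

Let smeas_y k : (k < N)%N -> smeas k.*2 (z k) -> smeas k.*2 (c k) ->
  smeas k.*2.+1 (y k).
Proof.
move=> kN /(smeas_le (leqnSn _)) mz /(smeas_le (leqnSn _)) mc.
have -> : y k = fun w => resolvent (eta k) A (z k w - eta k *:
    (F (z k w) + delta (xi k w) (z k w) + a k *: (z k w - c k w))).
  by apply/funext => w; rewrite yE.
apply: (@smeas_lip _ 1).
  by move=> x x'; rewrite mul1r; exact: resolvent_nonexpansive.
apply: smeasB => //; apply: smeasZ; apply: smeasD.
  by apply: smeasD; [exact: smeasF|exact: smeas_xi].
by apply: smeasZ; exact: smeasB.
Qed.

Let smeas_zc k : (k <= N)%N -> smeas k.*2 (z k) /\ smeas k.*2 (c k).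
Proof.
elim: k => [_|k IH kN].
  have -> : z 0 = fun=> z0 by apply/funext.
  have -> : c 0 = fun=> z0 by apply/funext.
  by split; exact: smeas_cst.
have [mz mc] := IH (ltnW kN); have my := smeas_y kN mz mc.
have le1 : (k.*2.+1 <= k.+1.*2)%N by rewrite doubleS.
have le2 : (k.*2 <= k.+1.*2)%N by rewrite doubleS leqW.
move: mz mc my => /(smeas_le le2) mz /(smeas_le le2) mc /(smeas_le le1) my.
have mzS : smeas k.+1.*2 (z k.+1).
  have -> : z k.+1 = fun w => y k w - eta k *:
    (F (y k w) + delta (zeta k w) (y k w) + a k *: (y k w - c k w)
     - (F (z k w) + delta (xi k w) (z k w)) - a k *: (z k w - c k w)).
    by apply/funext => w; rewrite zS.
  apply: smeasB => //; apply: smeasZ; apply: smeasB; last first.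
    by apply: smeasZ; exact: smeasB.
  apply: smeasB; first apply: smeasD.
  - apply: smeasD; first exact: smeasF.
    by apply: smeas_zeta => //; rewrite doubleS.
  - by apply: smeasZ; exact: smeasB.
  - apply: smeasD; first exact: smeasF.
    by apply: smeas_xi => //; rewrite doubleS.
split=> //.
have -> : c k.+1 = fun w => (a k.+1)^-1 *:
    (a k *: c k w + (a k.+1 - a k) *: z k.+1 w).
  by apply/funext => w; rewrite cS.
by apply: smeasZ; apply: smeasD; exact: smeasZ.
Qed.

Let x k w := reg_sol A F (a k) (c k w).
Let d k w := `|z k w - x k w|.

Let smeas_x k : (k <= N)%N -> smeas k.*2 (x k).
Proof.
move=> kN; apply: (@smeas_lip _ 1); last exact: (smeas_zc kN).2.
by move=> u v; rewrite mul1r; exact: (reg_sol_nonexpansive hdot hA hFmono hFlip L0).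
Qed.

Let measurable_d k : (k <= N)%N -> measurable_fun [set: Om] (d k).
Proof.
move=> kN; apply: (@smeas_norm k.*2).
by apply: smeasB; [exact: (smeas_zc kN).1|exact: smeas_x].
Qed.

Let update k w :
  [/\ d k.+1 w <= `|z k.+1 w - x k w|,
      a k * `|x k.+1 w - x k w| <= (a k.+1 - a k) * d k.+1 w &
      `|a k.+1 *: (c k.+1 w - x k.+1 w)|
        <= `|a k *: (c k w - x k w)| + (a k.+1 - a k) * d k.+1 w].
Proof.
have l0 : 0 <= a k.+1 - a k by rewrite subr_ge0.
have e : (a k + (a k.+1 - a k)) *: c k.+1 w =
    a k *: c k w + (a k.+1 - a k) *: z k.+1 w.
  by rewrite subrKC cS scalerA divff ?scale1r// gt_eqF.
by have := reg_sol_update hdot hA hFmono hFlip L0 (a_gt0 k) l0 e; rewrite subrKC.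
Qed.

Let S := 5 / (4 * (Q + 1)).
Let S0 : 0 <= S.
Proof. by apply: divr_ge0 => //; apply: mulr_ge0 => //; have := Q1; lra. Qed.
Let B k := D ^+ 2 * (a 0 / a k) ^+ 4 + S * sigma ^+ 2 / a k ^+ 2.

Let noise_xi k f : (k < N)%N -> smeas k.*2 f ->
  (\int[P]_w (`|delta (xi k w) (f w)| ^+ 2)%:E <= (sigma ^+ 2)%:E)%E.
Proof.
move=> kN mf.
(* With first map 0 and step -1, [fresh] bounds the noise itself. *)
have := @fresh k.*2 (inl (Ordinal kN)) (fun=> 0) f (-1) (leqnn _) (smeas_cst _ _) mf.
rewrite sqrrN expr1n mul1r.
under eq_integral do rewrite scaleN1r opprK add0r /=.
under [X in (_ <= X + _)%E]eq_integral do rewrite normr0 expr0n /=.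
by rewrite integral0 add0e.
Qed.

Let error_second_moment k : (k <= N)%N ->
  (\int[P]_w (d k w ^+ 2)%:E <= (B k)%:E)%E.
Proof.
elim: k => [_|k IH kN].
  apply: (@le_trans _ _ (\int[P]_w (D ^+ 2)%:E)%E).
    apply: le_integral_ge0 => w; first by rewrite lee_fin sqr_ge0.
    rewrite lee_fin /d /x z_0 c_0 ler_pXn2r ?nnegrE// ?(ltW D0)//.
    apply: le_trans hD.
    exact: (reg_sol_le hdot hA hFmono hFlip L0 z0 (a_gt0 0) hzstar).
  rewrite integral_cst// [X in (_ * X)%E]probability_setT mule1 lee_fin /B.
  rewrite divff ?gt_eqF// expr1n mulr1 lerDl.
  by apply: divr_ge0; [apply: mulr_ge0 => //|]; exact: sqr_ge0.
have {}IH := IH (ltnW kN); have [mz mc] := smeas_zc (ltnW kN).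
have my := smeas_y kN mz mc; have mx := smeas_x (ltnW kN).
(* V is z_{k+1} - x_k without the noise of [zeta k]. It is known at time 2k + 1, so that noise adds
   only its variance, turning the coefficient 3/2 into 5/2. *)
pose V w := y k w - eta k *: (F (y k w) + a k *: (y k w - c k w) - F (z k w)
  - delta (xi k w) (z k w) - a k *: (z k w - c k w)) - x k w.
have zV w : z k.+1 w - x k w = V w - eta k *: delta (zeta k w) (y k w).
  by rewrite zS /V; vector hdot; ring.
have mV : smeas k.*2.+1 V.
  move: mz mc mx => /(smeas_le (leqnSn _)) mz /(smeas_le (leqnSn _)) mc.
  move=> /(smeas_le (leqnSn _)) mx.
  apply: smeasB => //; apply: smeasB => //; apply: smeasZ; apply: smeasB.
    apply: smeasB; last exact: smeas_xi.
    apply: smeasB; last exact: smeasF.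
    apply: smeasD; first exact: smeasF.
    by apply: smeasZ; exact: smeasB.
  by apply: smeasZ; exact: smeasB.
pose t := eta k * a k; pose rho := 1 - 2 * t / (1 + 3 * t).
have t0 : 0 < t by rewrite mulr_gt0.
have rho0 : 0 <= rho.
  by rewrite subr_ge0 ler_pdivrMr; have := eta_ratio k; rewrite -/t; nra.
have hV w : `|V w| ^+ 2 <=
    rho * d k w ^+ 2 + 3 / 2 * eta k ^+ 2 * `|delta (xi k w) (z k w)| ^+ 2.
  have := extragradient_step hdot hA hFmono hFlip L0 (c k w) (z k w)
    (delta (xi k w) (z k w)) (a_gt0 k) (eta_gt0 k) (eta_lip k).
  by rewrite /= -yE.
have md : measurable_fun [set: Om] (fun w => (d k w ^+ 2)%:E).
  by apply/measurable_EFinP/measurable_funX/measurable_d; exact: ltnW.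
have mdel : measurable_fun [set: Om] (fun w => (`|delta (xi k w) (z k w)| ^+ 2)%:E).
  apply/measurable_EFinP/measurable_funX/(@smeas_norm k.*2.+1).
  by apply: smeas_xi => //; apply: smeas_le mz.
have e0 : 0 <= 3 / 2 * eta k ^+ 2 by rewrite mulr_ge0 ?sqr_ge0.
have hEV : (\int[P]_w (`|V w| ^+ 2)%:E <=
    (rho * B k + 3 / 2 * eta k ^+ 2 * sigma ^+ 2)%:E)%E.
  apply: (@le_trans _ _ (\int[P]_w (rho%:E * (d k w ^+ 2)%:E +
      (3 / 2 * eta k ^+ 2)%:E * (`|delta (xi k w) (z k w)| ^+ 2)%:E))%E).
    apply: le_integral_ge0 => w; first by rewrite lee_fin sqr_ge0.
    by rewrite -!EFinM -EFinD lee_fin.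
  rewrite ge0_integralD//; first last.
  - exact: measurable_funeM.
  - by move=> w _; rewrite -EFinM lee_fin mulr_ge0// sqr_ge0.
  - exact: measurable_funeM.
  - by move=> w _; rewrite -EFinM lee_fin mulr_ge0// sqr_ge0.
  rewrite !ge0_integralZl_EFin//; try by move=> w _; rewrite lee_fin sqr_ge0.
  rewrite (EFinD (rho * B k)) (EFinM rho) (EFinM (3 / 2 * eta k ^+ 2)).
  apply: leeD.
    by apply: lee_wpmul2l => //; rewrite lee_fin.
  by apply: lee_wpmul2l; [rewrite lee_fin|exact: noise_xi].
apply: (@le_trans _ _ (\int[P]_w (`|z k.+1 w - x k w| ^+ 2)%R%:E)%E).
  apply: le_integral_ge0 => w; first by rewrite lee_fin sqr_ge0.
  by rewrite lee_fin ler_pXn2r ?nnegrE ?normr_ge0//; have [] := update k w.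
under eq_integral do rewrite zV.
apply: le_trans (@fresh k.*2.+1 (inr (Ordinal kN)) _ _ _ (leqnn _) mV my) _.
apply: le_trans (leeD hEV (lexx _)) _; rewrite -EFinD lee_fin.
have := error_recursion D sigma Q1 (a_gt0 k) (a_gt0 k.+1) (a_gt0 0) (eta_gt0 k)
  (eta_ratio k) (aS k).
rewrite /= -/t -/rho -/S -/(B k) -/(B k.+1) => h; apply: le_trans h.
by lra.
Qed.

Let s := Num.sqrt S.
(** A bound on the square root of [B k], split into bias and noise so that sums against the schedule
    split as well. *)
Let beta k := D * (a 0 / a k) ^+ 2 + s * sigma / a k.

Let beta_ge0 k : 0 <= beta k.
Proof.
apply: addr_ge0; first by apply: mulr_ge0; [exact: ltW|exact: sqr_ge0].
by apply: divr_ge0; [apply: mulr_ge0 => //; exact: sqrtr_ge0|exact: ltW].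
Qed.

Let l2_d k : (k <= N)%N -> l2_le P (d k) (beta k).
Proof.
move=> kN; split; [exact: measurable_d|exact: beta_ge0|].
apply: le_trans (error_second_moment kN) _; rewrite lee_fin /B /beta.
have -> : D ^+ 2 * (a 0 / a k) ^+ 4 = (D * (a 0 / a k) ^+ 2) ^+ 2 by ring.
have -> : S * sigma ^+ 2 / a k ^+ 2 = (s * sigma / a k) ^+ 2.
  by rewrite !exprMn exprVn sqr_sqrtr.
rewrite sqrrD lerD2r lerDl mulrn_wge0// mulr_ge0//.
  by rewrite mulr_ge0 ?sqr_ge0// ltW.
by rewrite divr_ge0 ?mulr_ge0 ?sqrtr_ge0// ltW.
Qed.

Let lam_ge0 k : 0 <= a k.+1 - a k. Proof. by rewrite subr_ge0. Qed.

Let reg_residual_le j w : `|a j *: (c j w - x j w)| <=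
  a 0 * D + \sum_(0 <= k < j) (a k.+1 - a k) * d k.+1 w.
Proof.
elim: j => [|j IH].
  rewrite big_geq// addr0 normrZ gtr0_norm// ler_pM2l// /x c_0; apply: le_trans hD.
  exact: (reg_sol_le hdot hA hFmono hFlip L0 z0 (a_gt0 0) hzstar).
rewrite big_nat_recr//= addrA; have [_ _ h] := update j w.
by apply: le_trans h _; rewrite lerD2r.
Qed.

Let drift_le k n w : (k <= n)%N -> `|x n w - x k w| <=
  \sum_(k <= j < n) (a j.+1 - a j) / a j * d j.+1 w.
Proof.
move=> kn; rewrite -(subnK kn) addnC; elim: (n - k)%N => [|i IH].
  by rewrite addn0 subrr normr0 big_geq.
rewrite addnS big_nat_recr ?leq_addr//=.
have [_ h _] := update (k + i)%N w.
have -> : x (k + i).+1 w - x k w =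
  (x (k + i)%N w - x k w) + (x (k + i).+1 w - x (k + i)%N w).
  by rewrite [RHS]addrC subrKA.
apply: le_trans (ler_normD _ _) _; apply: lerD => //.
by rewrite mulrAC ler_pdivlMr// mulrC.
Qed.

(** Each new noise is fresh for the partial sum, so the variance bounds add. Measurability is part
    of the induction because [fresh] requires it. *)
Let noise_sum k0 j f : (k0 <= j <= N)%N -> (forall k, (k < N)%N -> smeas k.*2 (f k)) ->
  smeas j.*2 (fun w => \sum_(k0 <= k < j) delta (xi k w) (f k w)) /\
  (\int[P]_w (`|\sum_(k0 <= k < j) delta (xi k w) (f k w)| ^+ 2)%:E
    <= ((j - k0)%:R * sigma ^+ 2)%:E)%E.
Proof.
move=> + mf; elim: j => [|j IH] /andP[k0j jN].
  have e : (fun w => \sum_(k0 <= k < 0) delta (xi k w) (f k w)) = fun=> 0.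
    by apply/funext => w; rewrite big_geq.
  split; first by rewrite e; exact: smeas_cst.
  under eq_integral do rewrite big_geq// normr0 expr0n /=.
  by rewrite integral0 lee_fin sub0n mul0r.
move: k0j; rewrite leq_eqVlt ltnS => /predU1P[->|k0j].
  have e : (fun w => \sum_(j.+1 <= k < j.+1) delta (xi k w) (f k w)) = fun=> 0.
    by apply/funext => w; rewrite big_geq.
  split; first by rewrite e; exact: smeas_cst.
  under eq_integral do rewrite big_geq// normr0 expr0n /=.
  by rewrite integral0 lee_fin subnn mul0r.
have [mS hS] : smeas j.*2 (fun w => \sum_(k0 <= k < j) delta (xi k w) (f k w)) /\
  (\int[P]_w (`|\sum_(k0 <= k < j) delta (xi k w) (f k w)| ^+ 2)%:E
    <= ((j - k0)%:R * sigma ^+ 2)%:E)%E by apply: IH; rewrite k0j ltnW.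
have e w : \sum_(k0 <= k < j.+1) delta (xi k w) (f k w) =
    \sum_(k0 <= k < j) delta (xi k w) (f k w) - (-1) *: delta (xi j w) (f j w).
  by rewrite big_nat_recr//= scaleN1r opprK.
split.
  under [X in smeas _ X]eq_fun do rewrite e.
  have le2 : (j.*2 <= j.+1.*2)%N by rewrite doubleS leqW.
  apply: smeasB; first exact: smeas_le mS.
  apply: smeasZ; apply: smeas_xi => //.
  by apply: smeas_le (mf _ jN).
under eq_integral do rewrite e.
apply: le_trans (@fresh j.*2 (inl (Ordinal jN)) _ _ _ (leqnn _) mS (mf _ jN)) _.
apply: le_trans (leeD hS (lexx _)) _; rewrite -EFinD lee_fin sqrrN expr1n mul1r.
by rewrite subSn// -natr1 mulrDl mul1r.
Qed.

Variables (m : nat) (l : R).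
Hypotheses (m_gt0 : (0 < m)%N) (mN : (m <= N)%N) (aN : a N = L).
Hypothesis sum1 : \sum_(0 <= k < N) (a k.+1 - a k) / a k.+1 <= l.
Hypothesis sum2 :
  \sum_(0 <= k < N) (a k.+1 - a k) / a k.+1 ^+ 2 <= (a 0)^-1 - L^-1.
Hypothesis tail : forall k, (N - m <= k <= N)%N -> L / a k <= 9 / 8.
Hypothesis tail1 : forall k, (N - m <= k <= N)%N ->
  \sum_(k <= j < N) (a j.+1 - a j) / (a j * a j.+1) <= (8 * L)^-1.
Hypothesis tail2 : forall k, (N - m <= k <= N)%N ->
  \sum_(k <= j < N) (a j.+1 - a j) / (a j * a j.+1 ^+ 2) <= 9 / (64 * L ^+ 2).

Let ss0 : 0 <= s * sigma. Proof. by rewrite mulr_ge0// sqrtr_ge0. Qed.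

(** The negative term, from the telescoped sum stopping at 1 / L, is kept: it produces the -1 in
    sqrt 2 - 1 of the final bound. *)
Let l2_reg : l2_le P
  (fun w => a 0 * D + \sum_(0 <= k < N) (a k.+1 - a k) * d k.+1 w)
  (2 * (a 0 * D) - a 0 ^+ 2 * D / L + s * sigma * l).
Proof.
have h : l2_le P
  (fun w => a 0 * D + \sum_(0 <= k < N) (a k.+1 - a k) * d k.+1 w)
  (a 0 * D + \sum_(0 <= k < N) (a k.+1 - a k) * beta k.+1).
  apply: l2_leD; first by apply: l2_le_cst; rewrite mulr_ge0// ltW.
  apply: l2_le_sum => k; rewrite mem_index_iota => /= kN.
  by apply: l2_leZ; [exact: lam_ge0|exact: l2_d].
apply: (l2_le_le _ _ _ h) => //; first by have [] := h.
have -> : \sum_(0 <= k < N) (a k.+1 - a k) * beta k.+1 =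
    a 0 ^+ 2 * D * (\sum_(0 <= k < N) (a k.+1 - a k) / a k.+1 ^+ 2) +
    s * sigma * (\sum_(0 <= k < N) (a k.+1 - a k) / a k.+1).
  rewrite !mulr_sumr -big_split /=; apply: eq_bigr => k _.
  by rewrite /beta; field; rewrite gt_eqF.
have h2 := ler_wpM2l (mulr_ge0 (sqr_ge0 (a 0)) (ltW D0)) sum2.
have h1 := ler_wpM2l ss0 sum1.
have e : a 0 ^+ 2 * D * ((a 0)^-1 - L^-1) = a 0 * D - a 0 ^+ 2 * D / L.
  by field; rewrite !gt_eqF.
by move: h1 h2; rewrite e; lra.
Qed.

(* [L / a_k <= 9 / 8] on the last m steps, 77/32 = 81/64 + 9/64 + 1 and
   9/4 = 9/8 + 1/8 + 1. *)
Let bias := 77 / 32 * (a 0 ^+ 2 * D / L) + 9 / 4 * (s * sigma).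

(** The function bounds |F z_k - F z_N| by going from z_k to z_N through x_k and x_N; its norm bound
    is uniform over the averaging window. *)
Let l2_bias k : (N - m <= k < N)%N -> l2_le P
  (fun w => L * (d k w + \sum_(k <= j < N) (a j.+1 - a j) / a j * d j.+1 w + d N w))
  bias.
Proof.
move=> /andP[mk kN]; have mkN : (N - m <= k <= N)%N by rewrite mk ltnW.
have h : l2_le P
  (fun w => L * (d k w + \sum_(k <= j < N) (a j.+1 - a j) / a j * d j.+1 w + d N w))
  (L * (beta k + \sum_(k <= j < N) (a j.+1 - a j) / a j * beta j.+1 + beta N)).
  apply: l2_leZ; first exact: ltW.
  apply: l2_leD; last exact: l2_d.
  apply: l2_leD; first by apply: l2_d; exact: ltnW.
  apply: l2_le_sum => j; rewrite mem_index_iota => /andP[_ jN].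
  by apply: l2_leZ; [exact: divr_ge0 (lam_ge0 j) (ltW _)|exact: l2_d].
apply: (l2_le_le _ _ _ h) => //; first by have [] := h.
have -> : \sum_(k <= j < N) (a j.+1 - a j) / a j * beta j.+1 =
    a 0 ^+ 2 * D * (\sum_(k <= j < N) (a j.+1 - a j) / (a j * a j.+1 ^+ 2)) +
    s * sigma * (\sum_(k <= j < N) (a j.+1 - a j) / (a j * a j.+1)).
  rewrite !mulr_sumr -big_split /=; apply: eq_bigr => j _.
  by rewrite /beta; field; rewrite !gt_eqF.
pose u := L / a k; have u0 : 0 <= u by rewrite divr_ge0// ltW.
have u98 : u <= 9 / 8 := tail mkN.
have u2 : u ^+ 2 <= 81 / 64 by nra.
pose p := a 0 ^+ 2 * D / L.
have p0 : 0 <= p by rewrite divr_ge0 ?mulr_ge0 ?sqr_ge0// ltW.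
have bk : L * beta k = p * u ^+ 2 + s * sigma * u.
  by rewrite /beta /p /u; field; rewrite !gt_eqF.
have bN : L * beta N = p + s * sigma.
  by rewrite /beta /p aN; field; rewrite !gt_eqF.
have h2 := ler_wpM2l (mulr_ge0 (ltW L0) (mulr_ge0 (sqr_ge0 (a 0)) (ltW D0))) (tail2 mkN).
have h1 := ler_wpM2l (mulr_ge0 (ltW L0) ss0) (tail1 mkN).
have e2 : L * (a 0 ^+ 2 * D) * (9 / (64 * L ^+ 2)) = 9 / 64 * p.
  by rewrite /p; field; rewrite !gt_eqF.
have e1 : L * (s * sigma) * (8 * L)^-1 = 1 / 8 * (s * sigma).
  by field; rewrite gt_eqF.
rewrite e1 in h1; rewrite e2 in h2.
have h3 := ler_wpM2l p0 u2; have h4 := ler_wpM2l ss0 u98.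
set s2 := \sum_(k <= j < N) _ in h2 *; set s1 := \sum_(k <= j < N) _ in h1 *.
rewrite /bias -/p (mulrDr L (_ + _) (beta N)) (mulrDr L (beta k)) bk bN.
by lra.
Qed.

Let noise_mean w := m%:R^-1 *: \sum_((N - m)%N <= k < N) delta (xi k w) (z k w).

Let l2_noise : l2_le P (fun w => `|noise_mean w|) (sigma / Num.sqrt m%:R).
Proof.
have mz k : (k < N)%N -> smeas k.*2 (z k) by move=> /ltnW/smeas_zc[].
have [mS hS] := @noise_sum (N - m)%N N z (introT andP (conj (leq_subr _ _) (leqnn _))) mz.
have m0 : 0 < m%:R :> R by rewrite ltr0n.
have h : l2_le P (fun w => `|\sum_((N - m)%N <= k < N) delta (xi k w) (z k w)|)
    (Num.sqrt m%:R * sigma).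
  split; [exact: smeas_norm mS|by rewrite mulr_ge0// sqrtr_ge0|].
  by rewrite exprMn sqr_sqrtr ?ler0n//; move: hS; rewrite subKn.
have := l2_leZ (k := m%:R^-1) _ h; rewrite invr_ge0 ler0n => /(_ isT).
have -> : m%:R^-1 * (Num.sqrt m%:R * sigma) = sigma / Num.sqrt m%:R.
  rewrite -[in m%:R^-1](sqr_sqrtr (ltW m0)); field.
  by rewrite gt_eqF// sqrtr_gt0.
move=> h'; apply: l2_le_le (lexx _) h'.
  apply: (@smeas_norm N.*2); exact: smeasZ.
by move=> w; rewrite /noise_mean normrZ ger0_norm ?invr_ge0//.
Qed.

Let Fbar w := m%:R^-1 *:
  \sum_((N - m)%N <= k < N) (F (z k w) + delta (xi k w) (z k w)).
Let zhat w := resolvent (1 / L) A (z N w - (1 / L) *: Fbar w).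

Let Fbar_le w : `|Fbar w - F (z N w)| <= `|noise_mean w| +
  m%:R^-1 * \sum_((N - m)%N <= k < N) (L * (d k w
    + \sum_(k <= j < N) (a j.+1 - a j) / a j * d j.+1 w + d N w)).
Proof.
have m0 : 0 < m%:R :> R by rewrite ltr0n.
have -> : Fbar w - F (z N w) = noise_mean w +
    m%:R^-1 *: \sum_((N - m)%N <= k < N) (F (z k w) - F (z N w)).
  rewrite /Fbar /noise_mean big_split /= sumrB big_const_nat iter_addr_0 subKn//.
  rewrite -[F _ *+ m]scaler_nat.
  move: (\sum_(_ <= k < N) F _) (\sum_(_ <= k < N) delta _ _).
  by move=> u v; vector hdot; field; rewrite gt_eqF.
apply: le_trans (ler_normD _ _) _; rewrite lerD2l normrZ ger0_norm ?invr_ge0//.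
rewrite ler_pM2l ?invr_gt0//; apply: le_trans (ler_norm_sum _ _ _) _.
apply: ler_sum_nat => k /andP[_ kN]; apply: le_trans (lipschitzE hFlip _ _) _.
rewrite ler_pM2l//.
have -> : z k w - z N w = z k w - x k w + (x k w - x N w) + (x N w - z N w).
  by vector hdot; ring.
apply: le_trans (ler_normD _ _) _; apply: lerD; last by rewrite distrC.
apply: le_trans (ler_normD _ _) _; rewrite lerD2l distrC.
exact: drift_le (ltnW kN).
Qed.

Let total := Num.sqrt 2 * (2 * (a 0 * D) - a 0 ^+ 2 * D / L + s * sigma * l
  + Num.sqrt 2 * L * (a 0 ^+ 2 * D / L ^+ 2 + s * sigma / L)
  + (sigma / Num.sqrt m%:R + bias)).

Lemma residual_second_moment :
  (\int[P]_w (residual F A (zhat w) ^+ 2) <= (total ^+ 2)%:E)%E /\ 0 <= total.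
Proof.
have m0 : 0 < m%:R :> R by rewrite ltr0n.
(* A measurable pathwise majorant of the residual; its three groups bound the regularized residual,
   the distance of z_N to x_N and the error of the averaged oracle. *)
pose W w := Num.sqrt 2 *
  (a 0 * D + \sum_(0 <= k < N) (a k.+1 - a k) * d k.+1 w
   + Num.sqrt 2 * L * d N w
   + (`|noise_mean w| + m%:R^-1 * \sum_((N - m)%N <= k < N) (L * (d k w
    + \sum_(k <= j < N) (a j.+1 - a j) / a j * d j.+1 w + d N w)))).
have [_ T0 hW] : l2_le P W total.
  apply: l2_leZ; first exact: sqrtr_ge0.
  apply: l2_leD; first apply: l2_leD; first exact: l2_reg.
    have -> : a 0 ^+ 2 * D / L ^+ 2 + s * sigma / L = beta N.
      by rewrite /beta aN; field; rewrite gt_eqF.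
    by apply: l2_leZ; [rewrite mulr_ge0 ?sqrtr_ge0// ltW|exact: l2_d].
  apply: l2_leD; first exact: l2_noise.
  have -> : bias = m%:R^-1 * \sum_((N - m)%N <= k < N) bias.
    rewrite big_const_nat iter_addr_0 subKn// -[bias *+ m]mulr_natl mulrA.
    by rewrite mulVf ?mul1r// gt_eqF.
  apply: l2_leZ; first by rewrite invr_ge0 ltW.
  apply: l2_le_sum => k; rewrite mem_index_iota; exact: l2_bias.
split=> //; apply: le_trans hW; apply: le_integral_ge0 => w.
  by rewrite expe_ge0//; apply: le_ereal_inf_tmp => _ [v _ <-]; rewrite lee_fin.
have [v Av hv] := forward_backward_residual_reg hdot hA hFmono hFlip L0 (c N w)
  (z N w) (Fbar w) (a_gt0 N).
have R0 : (0 <= residual F A (zhat w))%E.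
  by apply: le_ereal_inf_tmp => _ [v' _ <-]; rewrite lee_fin.
have vW : `|v| <= W w.
  apply: le_trans hv _; apply: ler_wpM2l; first exact: sqrtr_ge0.
  by apply: lerD; [apply: lerD => //; exact: reg_residual_le|exact: Fbar_le].
have W0 : 0 <= W w by apply: le_trans vW.
have RW : (residual F A (zhat w) <= (W w)%:E)%E.
  apply: (@le_trans _ _ (`|v|%:E)); last by rewrite lee_fin.
  by apply: ereal_inf_lbound; exists v.
by rewrite EFin_expe lee_sqr.
Qed.

End Process.

(** * The algorithm *)

Section Trajectory.
Context {R : realType} {H : completeNormedModType R} {Xi : Type}.
Variables (A : H -> set H) (G : Xi -> H -> H) (z0 : H).
Variables (a eta : nat -> R) (xi zeta : nat -> Xi).

Let lambda k := a k.+1 - a k.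

Lemma rrseg_aE k : rrseg_a (a 0) lambda k = a k.
Proof. by elim: k => //= k ->; rewrite subrKC. Qed.

Let zc := rrseg_zc A G z0 (a 0) eta lambda xi zeta.
Let y k := rrseg_y A G (a 0) eta lambda xi k (zc k).1 (zc k).2.

Lemma rrseg_yE k : y k = resolvent (eta k) A
  ((zc k).1 - eta k *: (G (xi k) (zc k).1 + a k *: ((zc k).1 - (zc k).2))).
Proof. by rewrite /y /rrseg_y rrseg_aE. Qed.

Lemma rrseg_zS k : (zc k.+1).1 = y k - eta k *:
  (G (zeta k) (y k) + a k *: (y k - (zc k).2) - G (xi k) (zc k).1
   - a k *: ((zc k).1 - (zc k).2)).
Proof. by rewrite /y /zc /=; case: rrseg_zc => z c /=; rewrite !rrseg_aE. Qed.

Lemma rrseg_cS k : (zc k.+1).2 =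
  (a k.+1)^-1 *: (a k *: (zc k).2 + (a k.+1 - a k) *: (zc k.+1).1).
Proof.
rewrite /zc /=; case: rrseg_zc => z c /=.
by rewrite !rrseg_aE /lambda subrKC.
Qed.

End Trajectory.

Unset Implicit Arguments.

Theorem corollary6p2 (R : realType) :
  exists2 C : R, 0 < C &
  forall (H : completeNormedModType R) (dot : {dot H for idfun})
    (hdot : norm_of_dot dot)
    (L D sigma : R) (hL : 0 < L) (hD : 0 < D) (hsigma : 0 <= sigma)
    (F : H -> H) (hFmono : monotone_map dot F) (hFlip : L.-lipschitz F)
    (A : H -> set H) (hA : maximally_monotone dot A)
    (z0 zstar : H) (hzstar : fwd_sum F A zstar 0) (hD0 : `|z0 - zstar| <= D)
    (dXi : measure_display) (Xi : measurableType dXi) (mu : probability Xi R)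
    (delta : Xi -> H -> H) (hdelta : strongly_measurable_noise delta)
    (hmean : forall z, has_mean dot mu (delta ^~ z) 0)
    (hvar : forall z,
       (\int[mu]_s ((`|delta s z| ^+ 2)%:E) <= (sigma ^+ 2)%:E)%E)
    (N : nat) (hN : (19 <= N)%N)
    (d : measure_display) (Omega : measurableType d) (P : probability Omega R)
    (xi zeta : nat -> {RV P >-> Xi})
    (hxi : forall k, (k < N)%N -> forall B, measurable B ->
       distribution P (xi k) B = mu B)
    (hzeta : forall k, (k < N)%N -> forall B, measurable B ->
       distribution P (zeta k) B = mu B)
    (hindep : mutually_independent P
       (fun i => (samples (N := N) xi zeta i : Omega -> Xi))),
  let gamma : R := 1 / 3 in
  let a0 : R := 18 * L / N%:R in
  let Q : R := ratio_Q N in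
  let m : nat := Num.truncn (Num.min Q N%:R) in
  let a := schedule_a gamma Q L a0 in
  let eta k := stepsize Q L (a k) in
  let lambda k := a k.+1 - a k in
  let G s z := F z + delta s z in
  let z (w : Omega) (k : nat) : H :=
    rrseg_z A G z0 a0 eta lambda (fun j => xi j w) (fun j => zeta j w) k in
  let Fbar (w : Omega) : H :=
    m%:R^-1 *: \sum_((N - m)%N <= k < N) G (xi k w) (z w k) in
  let zhat (w : Omega) : H :=
    resolvent (1 / L) A (z w N - (1 / L) *: Fbar w) in
  let ER2 : \bar R := (\int[P]_w (residual F A (zhat w) ^+ 2))%E in
  [/\ 1 < Q,
      (sqrte ER2 <=
        (36 * Num.sqrt 2 * L * D / N%:R
         + 324 * Num.sqrt 2 * L * D / N%:R ^+ 2
           * (Num.sqrt 2 - 1 + 77 / 32)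
         + Num.sqrt 2 * sigma / Num.sqrt m%:R
         + sigma * Num.sqrt (5 / (2 * (Q + 1)))
           * (ln (N%:R / 18) + Num.sqrt 2 + 9 / 4))%:E)%E &
      (ER2 <= (C * (L ^+ 2 * D ^+ 2 / N%:R ^+ 2
                    + sigma ^+ 2 * ln N%:R ^+ 3 / N%:R))%:E)%E].
Proof.
exists (3 * 131 ^+ 2); first by rewrite mulr_gt0// exprn_gt0.
move=> H dot hdot L D sigma hL hD hsigma F hFmono hFlip A hA z0 zstar hzstar hD0.
move=> dXi Xi mu delta hdelta hmean hvar N hN d Omega P xi zeta hxi hzeta hindep.
move=> gamma a0 Q m a eta lambda G z Fbar zhat ER2.
have Q1 := @ratio_Q_gt1 R N hN.
pose zc w := rrseg_zc A G z0 (a 0) eta lambda (fun j => xi j w) (fun j => zeta j w).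
pose y k w := rrseg_y A G (a 0) eta lambda (fun j => xi j w) k (zc w k).1 (zc w k).2.
have N0 : 0 < N%:R :> R by rewrite ltr0n (leq_trans _ hN).
have [ER2_le T0] := residual_second_moment hdot hL hD hsigma hFmono hFlip hA
  hzstar hD0 hdelta hmean hvar hxi hzeta hindep (ltW Q1)
  (schedule_a_gt0 hN hL) (schedule_a_incr hN hL) (stepsize_gt0 hN hL)
  (stepsize_lipschitz hN hL) (stepsize_ratio hN hL) (schedule_aS hN hL)
  (z := fun k w => (zc w k).1) (c := fun k w => (zc w k).2) (y := y)
  (fun=> erefl) (fun=> erefl)
  (fun k w => rrseg_yE A G z0 a eta (fun j => xi j w) (fun j => zeta j w) k)
  (fun k w => rrseg_zS A G z0 a eta (fun j => xi j w) (fun j => zeta j w) k)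
  (fun k w => rrseg_cS A G z0 a eta (fun j => xi j w) (fun j => zeta j w) k)
  (@truncn_ratio_gt0 R N hN) (@truncn_ratio_leN R N hN) (schedule_a_last hN hL)
  (schedule_sum_inv hN hL) (schedule_sum_invX2 hN hL) (schedule_a_tail hN hL)
  (schedule_tail_sum_inv hN hL) (schedule_tail_sum_invX2 hN hL).
set total := Num.sqrt 2 * _ in ER2_le T0.
set bound := (X in (_ <= X%:E)%E).
have totalE : total = bound.
  rewrite /total /bound -/Q; set r2 := Num.sqrt 2.
  have Q0 : 0 < Q + 1 by rewrite addr_gt0// (lt_trans ltr01 Q1).
  (* The outer sqrt 2 of the residual bound is absorbed here, turning S = 5 / (4 (Q + 1)) into the
     constant of the statement. *)
  have -> : Num.sqrt (5 / (2 * (Q + 1))) = r2 * Num.sqrt (5 / (4 * (Q + 1))).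
    by rewrite /r2 -sqrtrM//; congr Num.sqrt; field; rewrite gt_eqF.
  have m0 : 0 < Num.sqrt (m%:R : R).
    by rewrite sqrtr_gt0 ltr0n; exact: truncn_ratio_gt0.
  rewrite [schedule_a _ _ _ _ 0]/= -/m.
  move: (Num.sqrt (5 / _)) (ln _) m0 => s l m0.
  by field; rewrite !gt_eqF.
have ER2_le' : (ER2 <= (bound ^+ 2)%:E)%E by rewrite -totalE.
split=> //.
  have -> : bound%:E = sqrte (bound ^+ 2)%:E.
    by rewrite /= sqrtr_sqr ger0_norm// -totalE.
  by rewrite lee_sqrt// lee_fin sqr_ge0.
apply: le_trans ER2_le' _; rewrite lee_fin.
exact: rate_bound.
Qed.
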